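(* Let $\mathbf{M}=G/K$ be a compact homogeneous manifold of dimension $n$, $\mathcal{L}$ the operator on $\mathbf{M}$ described in the context, and let $\phi^j_k$ ($j\in\mathbb{Z}$, $1\le k\le\mathcal{N}_j$) be the functions constructed in the context from a number $a>1$, a function $f$, and cubature nodes $x^j_k$ with weights $b^j_k$. Let $P$ be the orthogonal projection of $L_2(\mathbf{M})$ onto the space of constant functions. Then the $\phi^j_k$ form a Parseval frame (normalized tight frame) for $(I-P)L_2(\mathbf{M})$; that is, every $\phi^j_k$ belongs to $(I-P)L_2(\mathbf{M})$ and $$\|(I-P)F\|_2^2=\sum_{j,k}|\langle F,\phi^j_k\rangle|^2\qquad\text{for all }F\in L_2(\mathbf{M}).$$
   Context: Homogeneous manifold and operator: $\mathbf{M}=G/K$ is a compact connected $C^\infty$ manifold of dimension $n$ on which a compact Lie group $G$ of dimension $d$ acts effectively and transitively by diffeomorphisms, endowed with a $G$-invariant Riemannian metric and invariant (Riemannian) measure $\mu=dx$. Let $Q$ be an $\mathrm{Ad}(G)$-invariant positive-definite quadratic form on the Lie algebra $\mathbf{g}$ which on $[\mathbf{g},\mathbf{g}]$ is the negative of the Killing form, $X_1,\dots,X_d$ a $Q$-orthonormal basis of $\mathbf{g}$, $D_jf(x)=\frac{d}{dt}\big|_{t=0}f(\exp(tX_j)\cdot x)$, and $\mathcal{L}=-D_1^2-\dots-D_d^2$. $\mathcal{L}$ is elliptic, self-adjoint and nonnegative on $L_2(\mathbf{M})$, with eigenvalues $0=\lambda_0<\lambda_1\le\lambda_2\le\dots\to\infty$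 and a corresponding orthonormal basis of real-valued eigenfunctions $u_0,u_1,\dots$; $\mathbf{E}_\omega(\mathcal{L})$ is the span of the eigenfunctions with eigenvalue $\le\omega$. $\rho$-lattices: there are a natural number $N_{\mathbf{M}}$ and $\rho_{\mathbf{M}}>0$, fixed once and for all, such that for $0<\rho<\rho_{\mathbf{M}}$ there exist sets $\{y_\nu\}\subset\mathbf{M}$ with: the balls $B(y_\nu,\rho/4)$ are disjoint, the balls $B(y_\nu,\rho/2)$ cover $\mathbf{M}$, and the cover by the balls $B(y_\nu,\rho)$ has multiplicity at most $N_{\mathbf{M}}$. Any such set is a $\rho$-lattice. Cubature: there is a (sufficiently small) constant $a_0>0$ such that for every $\omega>0$ and every $\rho$-lattice $\{x_k\}$ with $\rho=a_0(\omega+1)^{-1/2}$ there are weights $\lambda_k>0$ with $\int_{\mathbf{M}}h\,dx=\sum_k\lambda_kh(x_k)$ for all $h\in\mathbf{E}_\omega(\mathcal{L})$ and $c_1\rho^n\le\lambda_k\le c_2\rho^n$, where $c_1,c_2>0$ do not depend on $\omega$ or the lattice. Construction: fix $a>1$ and $f\in C_c^\infty$ supported in $[a^{-2},a^4]$ with $\sum_{j=-\infty}^\infty|f(a^{-2j}s)|^2=1$ for all $s>0$. For each $j\in\mathbb{Z}$ put $\rho_j=a_0(4da^{2j+4}+1)^{-1/2}$, choose a $\rho_j$-lattice $M_{\rho_j}=\{x^j_k:1\le k\le\mathcal{N}_j\}$, and let $b^j_k>0$ ($1\le k\le\mathcal{N}_j$) be cubature weights for this lattice and $\omega=4da^{2j+4}$,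 that is, weights with $\int_{\mathbf{M}}h\,dx=\sum_{k=1}^{\mathcal{N}_j}b^j_kh(x^j_k)$ for all $h\in\mathbf{E}_{4da^{2j+4}}(\mathcal{L})$ and $c_1\rho_j^n\le b^j_k\le c_2\rho_j^n$ (so $b^j_k$ is comparable to $\rho_j^n$ with constants independent of $j,k$). Define $$\varphi^j_k(y)=\sum_m\overline{f(a^{-2j}\lambda_m)}\,\overline{u_m(x^j_k)}\,u_m(y),\qquad \phi^j_k=\sqrt{b^j_k}\,\varphi^j_k .$$ $\langle\cdot,\cdot\rangle$ is the $L_2(\mathbf{M},\mu)$ inner product. *)

(* Defs.v *)
From HB Require Import structures.
From mathcomp Require Import all_boot all_order all_algebra.
From mathcomp Require Import complex.
From mathcomp Require Import all_classical all_reals all_analysis.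

Set Implicit Arguments.
Unset Strict Implicit.
Unset Printing Implicit Defensive.

Import Order.TTheory GRing.Theory Num.Theory.
Import numFieldNormedType.Exports.

Local Open Scope classical_set_scope.
Local Open Scope ring_scope.

(* f is of class C^k on the open set U. The model spaces used below are finite
   dimensional, so that f is C^(k+1) iff it is Fréchet differentiable and all
   its directional derivatives are C^k. *)
Fixpoint Ck (R : realType) (V W : normedModType R) (k : nat) (U : set V)
    (f : V -> W) : Prop :=
  if k is k'.+1 then
    (forall x, U x -> differentiable f x) /\ (forall v, Ck k' U ('D_v f))
  else forall x, U x -> {for x, continuous f}.

Definition Cinfty (R : realType) (V W : normedModType R) (U : set V)
    (f : V -> W) : Prop := forall k, Ck k U f.

(* The values of [cmap] outside [dom] and of [cinv] outside [cmap @` dom] are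
   irrelevant. *)
Record chart (V T : Type) := Chart {
  dom : set T;
  cmap : T -> V;
  cinv : V -> T }.

(* An atlas together with a preferred chart around each point; the tangent
   space at x is the model space V, read in the chart [chart_at x]. *)
Record charted (V T : Type) := Charted {
  atlas : set (chart V T);
  chart_at : T -> chart V T }.

Record is_chart (R : realType) (V : normedModType R) (T : topologicalType)
    (c : chart V T) : Prop := {
  chart_dom_open : open (dom c);
  chart_codom_open : open (cmap c @` dom c);
  chart_cancel : forall x, dom c x -> cinv c (cmap c x) = x;
  chart_continuous : forall x, dom c x -> {for x, continuous (cmap c)};
  chart_inv_continuous :
    forall x, dom c x -> {for cmap c x, continuous (cinv c)} }.

Definition smooth_map (R : realType) (V W : normedModType R)
    (S T : topologicalType) (A : charted V S) (B : charted W T)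
    (F : S -> T) : Prop :=
  continuous F /\
  forall c c', atlas A c -> atlas B c' ->
    Cinfty (cmap c @` (dom c `&` F @^-1` dom c')) (cmap c' \o F \o cinv c).

Record is_manifold (R : realType) (V : normedModType R) (T : topologicalType)
    (A : charted V T) : Prop := {
  mfd_hausdorff : hausdorff_space T;
  mfd_second_countable : @second_countable T;
  mfd_chart : forall c, atlas A c -> is_chart c;
  mfd_chart_at : forall x, atlas A (chart_at A x) /\ dom (chart_at A x) x;
  mfd_transition : forall c c', atlas A c -> atlas A c' ->
    Cinfty (cmap c @` (dom c `&` dom c')) (cmap c' \o cinv c) }.

Definition self_charted (V : Type) : charted V V :=
  let c := Chart setT id id in Charted [set c] (fun=> c).

Definition prod_chart (V W S T : Type) (c : chart V S) (c' : chart W T) :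
    chart (V * W) (S * T) :=
  Chart (dom c `*` dom c') (fun p => (cmap c p.1, cmap c' p.2))
        (fun q => (cinv c q.1, cinv c' q.2)).

Definition prod_charted (V W S T : Type) (A : charted V S) (B : charted W T) :
    charted (V * W) (S * T) :=
  Charted
    [set c | exists c1 c2, [/\ atlas A c1, atlas B c2 & c = prod_chart c1 c2]]
    (fun p => prod_chart (chart_at A p.1) (chart_at B p.2)).

Definition smooth_fun (R : realType) (V : normedModType R)
    (T : topologicalType) (A : charted V T) (f : T -> R) : Prop :=
  smooth_map A (self_charted R) f.

Definition smooth_curve (R : realType) (V : normedModType R)
    (T : topologicalType) (A : charted V T) (g : R -> T) : Prop :=
  smooth_map (self_charted R) A g.

(* The matrix of the differential T_x S -> T_(F x) T, acting on row vectors. *)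
Definition tangent_mx (R : realType) (m n : nat) (S T : topologicalType)
    (A : charted 'rV[R]_m S) (B : charted 'rV[R]_n T) (F : S -> T) (x : S) :
    'M[R]_(m, n) :=
  jacobian (cmap (chart_at B (F x)) \o F \o cinv (chart_at A x))
           (cmap (chart_at A x) x).

Definition velocity (R : realType) (n : nat) (T : topologicalType)
    (A : charted 'rV[R]_n T) (g : R -> T) (t : R) : 'rV[R]_n :=
  derive1 (cmap (chart_at A (g t)) \o g) t.

#[short(type="ptopologicalGroupType")]
HB.structure Definition PTopologicalGroup :=
  {G of Group G & PointedTopological G}.

Section LieGroup.
Context (R : realType) (d : nat) (G : ptopologicalGroupType).
Variable A : charted 'rV[R]_d G.

Record is_lie_group : Prop := {
  lie_manifold : is_manifold A;
  lie_mul : smooth_map (prod_charted A A) A (fun p : G * G => (p.1 * p.2)%g);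
  lie_inv : smooth_map A A (fun g : G => g^-1%g) }.

(* The Lie algebra is the tangent space 'rV[R]_d at the identity. [Ad_mx g] is
   the matrix of Ad(g), the differential at the identity of conjugation by g;
   [ad_mx X] is that of ad(X), where ad is the differential at the identity of
   Ad; and [X, Y] = ad(X) Y. *)
Definition Ad_mx (g : G) : 'M[R]_d :=
  tangent_mx A A (fun y : G => (g * y * g^-1)%g) 1%g.

Definition ad_mx (X : 'rV[R]_d) : 'M[R]_d :=
  'D_X (Ad_mx \o cinv (chart_at A 1%g)) (cmap (chart_at A 1%g) 1%g).

Definition lie_bracket (X Y : 'rV[R]_d) : 'rV[R]_d := Y *m ad_mx X.

Definition killing (X Y : 'rV[R]_d) : R := \tr (ad_mx X *m ad_mx Y).

Definition derived_algebra : set 'rV[R]_d :=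
  [set X | exists (k : nat) (Y Z : 'I_k -> 'rV[R]_d),
     X = \sum_i lie_bracket (Y i) (Z i)].

(* t |-> exp(tX) is the one-parameter subgroup with initial velocity X *)
Definition is_exponential (expG : 'rV[R]_d -> G) : Prop :=
  forall X, [/\ smooth_curve A (fun t => expG (t *: X)),
    forall s t, expG ((s + t) *: X) = (expG (s *: X) * expG (t *: X))%g,
    expG 0 = 1%g
  & velocity A (fun t => expG (t *: X)) 0 = X].

Definition polar (Q : 'rV[R]_d -> R) (X Y : 'rV[R]_d) : R :=
  (Q (X + Y) - Q X - Q Y) / 2.

Record is_quadratic_form (Q : 'rV[R]_d -> R) : Prop := {
  quad_scale : forall a X, Q (a *: X) = a ^+ 2 * Q X;
  quad_polar : forall Y a X X',
    polar Q (a *: X + X') Y = a * polar Q X Y + polar Q X' Y }.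

Record is_invariant_form (Q : 'rV[R]_d -> R) : Prop := {
  inv_form_quadratic : is_quadratic_form Q;
  inv_form_pos : forall X, X != 0 -> 0 < Q X;
  inv_form_Ad : forall g X, Q (X *m Ad_mx g) = Q X;
  inv_form_killing : forall X, derived_algebra X -> Q X = - killing X X }.

Definition is_orthonormal_family (Q : 'rV[R]_d -> R) (X : 'I_d -> 'rV[R]_d) :
    Prop :=
  forall i j, polar Q (X i) (X j) = (i == j)%:R.

End LieGroup.

Record is_homogeneous (R : realType) (d n : nat) (G : ptopologicalGroupType)
    (M : ptopologicalType) (A : charted 'rV[R]_d G) (B : charted 'rV[R]_n M)
    (act : G -> M -> M) : Prop := {
  hom_group : is_lie_group A;
  hom_group_compact : compact [set: G];
  hom_manifold : is_manifold B;
  hom_manifold_compact : compact [set: M];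
  hom_manifold_connected : connected [set: M];
  hom_act_smooth :
    smooth_map (prod_charted A B) B (fun p : G * M => act p.1 p.2);
  hom_act1 : forall x, act 1%g x = x;
  hom_actM : forall g g' x, act (g * g')%g x = act g (act g' x);
  hom_effective : forall g, (forall x, act g x = x) -> g = 1%g;
  hom_transitive : forall x y, exists g, act g x = y }.

Section Riemannian.
Context (R : realType) (n : nat) (M : ptopologicalType).
Variable B : charted 'rV[R]_n M.

(* h x is the Gram matrix of the metric at x in the chart [chart_at B x];
   [gram h c x] is its Gram matrix at x in the chart c. *)
Definition gram (h : M -> 'M[R]_n) (c : chart 'rV[R]_n M) (x : M) : 'M[R]_n :=
  let J := jacobian (cmap (chart_at B x) \o cinv c) (cmap c x) in
  J *m h x *m J^T.

Record is_riemannian_metric (h : M -> 'M[R]_n) : Prop := {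
  metric_sym : forall x, (h x)^T = h x;
  metric_pos : forall x (v : 'rV[R]_n), v != 0 -> 0 < (v *m h x *m v^T) 0 0;
  metric_smooth : forall c, atlas B c -> forall i j,
    Cinfty (cmap c @` dom c) (fun v => gram h c (cinv c v) i j) }.

Definition invariant_metric (G : Type) (act : G -> M -> M)
    (h : M -> 'M[R]_n) : Prop :=
  forall g x, let J := tangent_mx B B (act g) x in
    J *m h (act g x) *m J^T = h x.

Definition speed (h : M -> 'M[R]_n) (g : R -> M) (t : R) : R :=
  let v := velocity B g t in Num.sqrt ((v *m h (g t) *m v^T) 0 0).

(* [path_length h x y l]: l is the length of a piecewise smooth path from x to
   y, presented as a chain of smooth curves restricted to [0, 1]. *)
Inductive path_length (h : M -> 'M[R]_n) : M -> M -> R -> Prop :=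
| path_nil x : path_length h x x 0
| path_cons (g : R -> M) y l :
    smooth_curve B g -> path_length h (g 1) y l ->
    path_length h (g 0) y
      (Rintegral (@lebesgue_measure R) `[0, 1] (speed h g) + l).

Definition rdist (h : M -> 'M[R]_n) (x y : M) : R :=
  inf [set l | path_length h x y l].

Definition rball (h : M -> 'M[R]_n) (x : M) (r : R) : set M :=
  [set y | rdist h x y < r].

End Riemannian.

Notation borel T := (g_sigma_algebraType (@open T)).

(* Lebesgue measure on R^n is the Borel measure giving boxes their volume. *)
Definition is_lebesgue_rV (R : realType) (n : nat)
    (leb : {measure set (borel 'rV[R]_n) -> \bar R}) : Prop :=
  forall a b : 'rV[R]_n, (forall i, a 0 i <= b 0 i) ->
    leb [set v : 'rV[R]_n | forall i, a 0 i <= v 0 i <= b 0 i] =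
    (\prod_i (b 0 i - a 0 i))%:E.

Definition is_riemannian_measure (R : realType) (n : nat)
    (M : ptopologicalType) (B : charted 'rV[R]_n M) (h : M -> 'M[R]_n)
    (mu : {measure set (borel M) -> \bar R}) : Prop :=
  exists2 leb : {measure set (borel 'rV[R]_n) -> \bar R}, is_lebesgue_rV leb &
    forall c, atlas B c -> forall E : set (borel M),
      measurable E -> E `<=` dom c ->
      mu E = (\int[leb]_(v in cmap c @` E)
                (Num.sqrt (\det (gram B h c (cinv c v))))%:E)%E.

Definition invariant_measure (R : realType) (G : Type) (M : ptopologicalType)
    (act : G -> M -> M) (mu : {measure set (borel M) -> \bar R}) : Prop :=
  forall g (E : set (borel M)), measurable E -> mu (act g @^-1` E) = mu E.

Section L2.
Context (R : realType) (M : ptopologicalType).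
Variable mu : {measure set (borel M) -> \bar R}.
Implicit Types F H : M -> R[i].

Definition norm2 F : \bar R :=
  (\int[mu]_(x in [set: borel M]) (Normc.normc (F x) ^+ 2)%:E)%E.

Definition L2 F : Prop :=
  [/\ measurable_fun [set: borel M] (fun x : borel M => complex.Re (F x)),
      measurable_fun [set: borel M] (fun x : borel M => complex.Im (F x))
    & (norm2 F < +oo)%E].

Definition cintegral F : R[i] :=
  Complex (Rintegral mu [set: borel M] (fun x => complex.Re (F x)))
          (Rintegral mu [set: borel M] (fun x => complex.Im (F x))).

Definition inner F H : R[i] := cintegral (fun x => F x * conjc (H x)).

Definition is_orthonormal_basis (e : nat -> M -> R[i]) : Prop :=
  [/\ forall m, L2 (e m),
      forall m m', inner (e m) (e m') = (m == m')%:R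
    & forall F, L2 F ->
        (fun k : nat =>
           norm2 (fun x => F x - \sum_(m < k) inner F (e m) * e m x))
          @ \oo --> 0%E].

Definition is_orthogonal_projection (E : set (M -> R[i]))
    (P : (M -> R[i]) -> M -> R[i]) : Prop :=
  forall F, L2 F ->
    E (P F) /\ forall H, E H -> inner (fun x => F x - P F x) H = 0.

Definition constants : set (M -> R[i]) := [set F | exists z, F = fun=> z].

(* Membership of (the class of) H in (I - P) L2 *)
Definition in_range_compl (P : (M -> R[i]) -> M -> R[i]) H : Prop :=
  L2 H /\ exists2 F, L2 F & {ae mu, forall x : borel M, H x = F x - P F x}.

End L2.

Section Operator.
Context (R : realType) (d n : nat) (G : ptopologicalGroupType)
  (M : ptopologicalType).
Variables (B : charted 'rV[R]_n M) (act : G -> M -> M) (expG : 'rV[R]_d -> G).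

Definition Dop (X : 'rV[R]_d) (f : M -> R) (x : M) : R :=
  derive1 (fun t => f (act (expG (t *: X)) x)) 0.

Definition Lop (X : 'I_d -> 'rV[R]_d) (f : M -> R) (x : M) : R :=
  - \sum_j Dop (X j) (Dop (X j) f) x.

Record is_eigenbasis (X : 'I_d -> 'rV[R]_d)
    (mu : {measure set (borel M) -> \bar R}) (ev : nat -> R)
    (u : nat -> M -> R) : Prop := {
  ev_0 : ev 0%N = 0;
  ev_1 : 0 < ev 1%N;
  ev_le : forall i j, (i <= j)%N -> ev i <= ev j;
  ev_cvg : ev @ \oo --> +oo;
  eig_smooth : forall m, smooth_fun B (u m);
  eig_eq : forall m x, Lop X (u m) x = ev m * u m x;
  eig_basis : is_orthonormal_basis mu (fun m x => (u m x)%:C%C) }.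

End Operator.

(* E_omega(L), with complex coefficients *)
Definition spectral_space (R : realType) (M : Type) (ev : nat -> R)
    (u : nat -> M -> R) (omega : R) : set (M -> R[i]) :=
  [set F | exists (k : nat) (z : nat -> R[i]),
     F = fun x => \sum_(m < k | ev m <= omega) z m * (u m x)%:C%C].

Section Cubature.
Context (R : realType) (n : nat) (M : ptopologicalType).
Variables (B : charted 'rV[R]_n M) (h : M -> 'M[R]_n).

Record is_rho_lattice (NM : nat) (rhoM rho : R) (N : nat) (y : 'I_N -> M) :
    Prop := {
  lattice_rho : 0 < rho < rhoM;
  lattice_disjoint : trivIset setT (fun k => rball B h (y k) (rho / 4));
  lattice_cover : forall x, exists k, rball B h (y k) (rho / 2) x;
  lattice_mult : forall x,
    (#|[pred k : 'I_N | (rdist B h (y k) x < rho)%R]| <= NM)%N }.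

Definition lattice_constants (NM : nat) (rhoM : R) : Prop :=
  0 < rhoM /\ forall rho, 0 < rho < rhoM ->
    exists N (y : 'I_N -> M), is_rho_lattice NM rhoM rho y.

Record is_cubature (mu : {measure set (borel M) -> \bar R}) (ev : nat -> R)
    (u : nat -> M -> R) (c1 c2 omega rho : R) (N : nat) (y : 'I_N -> M)
    (w : 'I_N -> R) : Prop := {
  cub_pos : forall k, 0 < w k;
  cub_exact : forall F, spectral_space ev u omega F ->
    cintegral mu F = \sum_k (w k)%:C%C * F (y k);
  cub_bound : forall k, c1 * rho ^+ n <= w k <= c2 * rho ^+ n }.

Definition mesh (a0 omega : R) : R := a0 * (Num.sqrt (omega + 1))^-1.

Definition cubature_constants (NM : nat) (rhoM : R)
    (mu : {measure set (borel M) -> \bar R}) (ev : nat -> R)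
    (u : nat -> M -> R) (a0 c1 c2 : R) : Prop :=
  [/\ 0 < a0, 0 < c1, 0 < c2
    & forall omega, 0 < omega -> forall N (y : 'I_N -> M),
        is_rho_lattice NM rhoM (mesh a0 omega) y ->
        exists w, is_cubature mu ev u c1 c2 omega (mesh a0 omega) y w].

End Cubature.

Record is_generator (R : realType) (a : R) (f : R -> R[i]) : Prop := {
  gen_smooth_Re : forall k t,
    derivable (derive1n k (fun s => complex.Re (f s))) t 1;
  gen_smooth_Im : forall k t,
    derivable (derive1n k (fun s => complex.Im (f s))) t 1;
  gen_support : closure [set s | f s != 0] `<=` `[a ^- 2, a ^+ 4];
  gen_unity : forall s, 0 < s ->
    (\esum_(j in [set: int])
       (Normc.normc (f (a ^ (- 2 * j) * s)) ^+ 2)%:E = 1)%E }.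

Definition band (R : realType) (d : nat) (a : R) (j : int) : R :=
  4 * d%:R * a ^ (2 * j + 4).

(* The sum over m is a [fsbigop] sum: as f has compact support and the
   eigenvalues tend to infinity, only finitely many of its terms are nonzero. *)
Definition frame_elt (R : realType) (M : Type) (ev : nat -> R)
    (u : nat -> M -> R) (a : R) (f : R -> R[i]) (j : int) (x : M) (b : R)
    (y : M) : R[i] :=
  (Num.sqrt b)%:C%C *
  \sum_(m \in [set: nat])
     (conjc (f (a ^ (- 2 * j) * ev m)) * conjc (u m x)%:C%C * (u m y)%:C%C).

(* Main.v *)
(* With u_i, u_j, u_m eigenfunctions, the point is that the product u_i u_j of
   two eigenfunctions with eigenvalues at most omega is orthogonal to u_m as
   soon as the eigenvalue of u_m exceeds 4 omega. As Q is Ad-invariant, L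
   commutes with translations, and each D_k preserves the eigenspaces of L; it
   thus acts on the span V of the u_i with eigenvalue at most omega by an
   antisymmetric matrix A_k, with -\sum_k A_k^2 the diagonal matrix of
   eigenvalues. The matrix T = (\int u_i u_j u_m)_(i,j) then satisfies
   ev_m T = -\sum_k [A_k, [A_k, T]], and taking the trace against T^T gives
   ev_m |T|^2 = \sum_k |[A_k, T]|^2 <= 4 omega |T|^2.

   Consequently the cubature formula of band 4 d a^(2j+4) integrates exactly
   |f(a^(-2j) L) F|^2, whose values at the nodes are the |<F, phi^j_k>|^2 / b^j_k.
   Summing the energies \sum_m |f(a^(-2j) ev_m)|^2 |<F, u_m>|^2 over j leaves
   \sum_(m >= 1) |<F, u_m>|^2, because f(0) = 0 and u_0 is constant. *)

Require Import Defs.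
From HB Require Import structures.
From mathcomp Require Import all_boot all_order all_algebra.
From mathcomp Require Import complex.
From mathcomp Require Import all_classical all_reals all_analysis.
From mathcomp Require Import measurable_realfun.
From mathcomp Require Import ring lra.

Set Implicit Arguments.
Unset Strict Implicit.
Unset Printing Implicit Defensive.

Import Order.TTheory GRing.Theory Num.Theory.
Import numFieldNormedType.Exports.

Local Open Scope classical_set_scope.
Local Open Scope ring_scope.

(** * Differential calculus *)

Section Ck_calculus.
Context (R : realType).
Implicit Types V W Z : normedModType R.

(** The constant 4 comes from |P - S|^2 <= 2 |P|^2 + 2 |S|^2 applied to the two halves of
    [A_k T - T A_k]: summed over k, each half is the trace of [T T^T] or [T^T T] against the
    diagonal matrix of eigenvalues, hence at most omega |T|^2. Invariance of the eigenspaces under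
    D_X is obtained on the group: the orthogonality of a translate of u_i to u_m is differentiated
    along exp(tX), which replaces any computation with brackets of derivations. The remaining
    obstacle is that the eigenbasis is complete in L_2 norm only, while cubature evaluates at
    points. An invariant measure under a transitive action charges every nonempty open set, so a
    continuous function with finitely many nonzero coefficients equals its expansion at every point.
    Hence D_X u_i and u_i u_j are genuine finite sums, and the way from the eigenfunctions to the
    cubature formula is finite-dimensional algebra; infinite sums enter only afterwards, through
    Parseval's identity and the exchange of the nonnegative sums over j and m. *)

Lemma eq_open_derive V W (U : set V) (f g : V -> W) v x : open U ->
  (forall y, U y -> f y = g y) -> U x -> 'D_v f x = 'D_v g x.
Proof.
move=> oU fg Ux; apply: near_eq_derive.
by near=> y; apply: fg; near: y; exact: open_nbhs_nbhs.
Unshelve. all: by end_near. Qed.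

(** The difference [g - f] has zero germ at [x], so its increment is o(h) and its differential is 0;
    adding it to [f] keeps differentiability. *)
Lemma near_eq_differentiable V W (f g : V -> W) x :
  (\forall y \near x, f y = g y) -> differentiable f x -> differentiable g x.
Proof.
move=> fg df; rewrite (_ : g = f + (g - f)); last first.
  by rewrite addrCA subrr addr0.
apply: (differentiableD df).
have fg0 : \forall h \near 0, f (h + x) = g (h + x).
  by move: fg; rewrite (near_shift 0 x); apply: filterS => h; rewrite /= subr0.
have e0 : (g - f) \o shift x = cst ((g - f) x) + \0 +o_ 0 id.
  apply/eqaddoP => _/posnumP[e]; near=> y.
  have fgx : f x = g x by exact: nbhs_singleton fg.
  have fgy : f (y + x) = g (y + x).
    by near: y.
  by rewrite !fctE /= fgy fgx !subrr addr0 subrr normr0 mulr_ge0.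
have c0 : continuous (\0 : V -> W) by move=> y; exact: cvg_cst.
by apply/diff_locallyP; rewrite (diff_unique c0 e0).
Unshelve. all: by end_near. Qed.

Lemma Ck_sub V W k (U U' : set V) (f : V -> W) : U' `<=` U ->
  Ck k U f -> Ck k U' f.
Proof.
elim: k f => [|k IHk] f sU /=; first by move=> cf x /sU; exact: cf.
by move=> [df Df]; split=> [x /sU /df//|v]; apply: IHk.
Qed.

(** Openness of [U] turns agreement on [U] into agreement of germs, which is inherited by every
    directional derivative. *)
Lemma eq_Ck V W k (U : set V) (f g : V -> W) : open U ->
  (forall y, U y -> f y = g y) -> Ck k U f -> Ck k U g.
Proof.
move=> oU; elim: k f g => [|k IHk] f g fg /=.
  move=> cf x Ux; have := cf x Ux; rewrite /prop_for /continuous_at -(fg x Ux).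
  apply: cvg_trans; apply: near_eq_cvg.
  by near=> y; apply: fg; near: y; exact: open_nbhs_nbhs.
move=> [df Df]; split=> [x Ux|v].
  apply: near_eq_differentiable (df x Ux).
  by near=> y; apply: fg; near: y; exact: open_nbhs_nbhs.
by apply: (IHk ('D_v f)) => // y Uy; exact: eq_open_derive oU fg Uy.
Unshelve. all: by end_near. Qed.

Lemma Ck_pred V W k (U : set V) (f : V -> W) : Ck k.+1 U f -> Ck k U f.
Proof.
elim: k f => [|k IHk] f /= [df Df].
  by move=> x Ux; apply: differentiable_continuous; exact: df.
by split=> // v; apply: IHk; exact: Df.
Qed.

Lemma Ck_cst V W k (U : set V) (c : W) : Ck k U (cst c : V -> W).
Proof.
elim: k c => [|k IHk] c /=; first by move=> x _; exact: cvg_cst.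
split=> // v; rewrite (_ : 'D_v _ = cst 0) //.
by apply/funext => x; rewrite derive_cst.
Qed.

Lemma CkD V W k (U : set V) (f g : V -> W) : open U ->
  Ck k U f -> Ck k U g -> Ck k U (f + g).
Proof.
move=> oU; elim: k f g => [|k IHk] f g /=.
  by move=> cf cg x Ux; apply: continuousD; [exact: cf|exact: cg].
move=> [df Df] [dg Dg]; split=> [x Ux|v].
  by apply: differentiableD; [exact: df|exact: dg].
apply: (eq_Ck oU (f := 'D_v f + 'D_v g)); last exact: IHk.
move=> x Ux; rewrite deriveD//; apply: diff_derivable;
  [exact: df|exact: dg].
Qed.

Lemma Ck_sum V W k (U : set V) (I : Type) (r : seq I) (f : I -> V -> W) :
  open U -> (forall i, Ck k U (f i)) -> Ck k U (\sum_(i <- r) f i).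
Proof.
move=> oU cf; elim: r => [|i r IH]; first by rewrite big_nil; exact: Ck_cst.
by rewrite big_cons; exact: CkD.
Qed.

Lemma CkM V k (U : set V) (f g : V -> R) : open U ->
  Ck k U f -> Ck k U g -> Ck k U (f * g).
Proof.
move=> oU; elim: k f g => [|k IHk] f g.
  by move=> cf cg x Ux; apply: continuousM; [exact: cf|exact: cg].
move=> cf cg; have cf' := Ck_pred cf; have cg' := Ck_pred cg.
move: cf cg => [df Df] [dg Dg]; split=> [x Ux|v].
  by apply: differentiableM; [exact: df|exact: dg].
apply: (eq_Ck oU (f := f * 'D_v g + g * 'D_v f)).
  move=> x Ux; rewrite deriveM//; apply: diff_derivable;
  [exact: df|exact: dg].
by apply: (CkD oU); apply: IHk => //; [exact: Dg|exact: Df].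
Qed.

Lemma continuous_coord_rV n i : continuous (fun v : 'rV[R]_n => v 0 i).
Proof. by move=> v; apply/differentiable_continuous/differentiable_coord. Qed.

Lemma derive_coord_rV V n (f : V -> 'rV[R]_n) v x i : differentiable f x ->
  'D_v (fun y => f y 0 i) x = ('D_v f x) 0 i.
Proof.
move=> df; rewrite derive_mx; last exact: diff_derivable.
by rewrite mxE.
Qed.

Lemma Ck_coord V n k (U : set V) (f : V -> 'rV[R]_n) i : open U ->
  Ck k U f -> Ck k U (fun y => f y 0 i).
Proof.
move=> oU; elim: k f => [|k IHk] f /=.
  move=> cf x Ux; apply: (@continuous_comp _ _ _ f (fun v : 'rV[R]_n => v 0 i)).
    exact: cf.
  exact: continuous_coord_rV.
move=> [df Df]; split=> [x Ux|v].
  apply: (@differentiable_comp _ _ _ _ f (fun v : 'rV[R]_n => v 0 i)).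
    exact: df.
  exact: differentiable_coord.
apply: (eq_Ck oU (f := fun y => ('D_v f y) 0 i)); last exact: IHk.
by move=> y Uy; rewrite derive_coord_rV//; exact: df.
Qed.

Lemma derive_comp_rV V n (f : V -> 'rV[R]_n) (g : 'rV[R]_n -> R) v x :
  differentiable f x -> differentiable g (f x) ->
  'D_v (g \o f) x = \sum_i ('D_v f x) 0 i * 'D_(delta_mx 0 i) g (f x).
Proof.
move=> df dg; have dgf : differentiable (g \o f) x.
  exact: differentiable_comp.
rewrite (deriveE _ dgf) (diff_comp df dg) /= -(deriveE _ df).
rewrite [X in 'd g _ X]row_sum_delta linear_sum; apply: eq_bigr => i _.
by rewrite linearZ /= (deriveE _ dg).
Qed.

(** The chain rule in coordinates writes the derivative as a sum of products of coordinates of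
    ['D_v f] with partial derivatives of [g] composed with [f], to which the induction hypothesis
    applies. Hence the intermediate space of row vectors and the scalar outer function. *)
Lemma Ck_comp V n k (U : set V) (U' : set 'rV[R]_n) (f : V -> 'rV[R]_n)
    (g : 'rV[R]_n -> R) : open U -> (forall x, U x -> U' (f x)) ->
  Ck k U f -> Ck k U' g -> Ck k U (g \o f).
Proof.
move=> oU UU'; elim: k g => [|k IHk] g.
  by move=> cf cg x Ux; apply: continuous_comp; [exact: cf|exact/cg/UU'].
move=> cf; have cf' := Ck_pred cf; move: cf => [df Df] [dg Dg]; split=> [x Ux|v].
  by apply: differentiable_comp; [exact: df|exact/dg/UU'].
apply: (eq_Ck oU (f := \sum_i ((fun y => ('D_v f y) 0 i) *
                                  ('D_(delta_mx 0 i) g \o f)))).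
  move=> x Ux; rewrite derive_comp_rV ?fct_sumE//; [exact: df|exact/dg/UU'].
apply: Ck_sum => // i; apply: CkM => //; last by apply: IHk => //; exact: Dg.
by apply: Ck_coord => //; exact: Df.
Qed.

Lemma is_diff_pairr V W (v0 : V) (w : W) :
  is_diff w (fun w => (v0, w)) (fun w => (0, w)).
Proof. exact: is_diff_pair. Qed.

Lemma differentiable_pairr V W (v0 : V) (w : W) :
  differentiable (fun w => (v0, w)) w.
Proof. by have ? := is_diff_pairr v0 w; exact: ex_diff. Qed.

Lemma open_pairr V W (U : set (V * W)) (v0 : V) :
  open U -> open [set w | U (v0, w)].
Proof.
move=> oU; apply: (@open_comp _ _ (fun w : W => (v0, w))) => // w _.
exact/differentiable_continuous/differentiable_pairr.
Qed.

Lemma derive_pairr V W Z (v0 : V) (f : V * W -> Z) (v w : W) :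
  differentiable f (v0, w) ->
  'D_v (fun w => f (v0, w)) w = 'D_(0, v) f (v0, w).
Proof.
move=> df; have dp := is_diff_pairr v0 w.
have dfp : differentiable (f \o (fun w => (v0, w))) w.
  by apply: differentiable_comp => //; exact: ex_diff.
by rewrite !deriveE// diff_comp//= diff_val.
Qed.

(** This freezes the group coordinate at the identity: a derivative of the action in a group
    direction becomes a function on a chart of the manifold. *)
Lemma Ck_pairr V W Z k (U : set (V * W)) (v0 : V) (f : V * W -> Z) :
  open U -> Ck k U f -> Ck k [set w | U (v0, w)] (fun w => f (v0, w)).
Proof.
move=> oU; elim: k f => [|k IHk] f /=.
  move=> cf w Uw; apply: (@continuous_comp _ _ _ (fun w => (v0, w)) f).
    exact/differentiable_continuous/differentiable_pairr.
  exact: cf.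
move=> [df Df]; split=> [w Uw|v].
  apply: (@differentiable_comp _ _ _ _ (fun w => (v0, w)) f).
    exact: differentiable_pairr.
  exact: df.
apply: (eq_Ck (f := fun w => 'D_(0, v) f (v0, w))); first exact: open_pairr.
  by move=> w Uw; rewrite derive_pairr//; exact: df.
exact: (IHk _ (Df (0, v))).
Qed.

End Ck_calculus.

(** * Charts and Lie groups *)

Lemma continuous_pair (X S T : topologicalType) (f : X -> S) (g : X -> T) x :
  {for x, continuous f} -> {for x, continuous g} ->
  {for x, continuous (fun y => (f y, g y))}.
Proof. exact: cvg_pair. Qed.

Lemma open_setX (S T : topologicalType) (O : set S) (O' : set T) :
  open O -> open O' -> open (O `*` O').
Proof.
move=> oO oO'; rewrite openE => -[x y] [Ox Oy].
by exists (O, O') => //; split; apply: open_nbhs_nbhs.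
Qed.

Section charts.
Context (R : realType).

Lemma chart_image_open (V : normedModType R) (T : topologicalType)
    (c : chart V T) (O : set T) :
  is_chart c -> open O -> open (cmap c @` (dom c `&` O)).
Proof.
move=> cc oO; rewrite openE => _ [x [dx Ox] <-].
have dcx : \forall q \near cmap c x, (cmap c @` dom c) q.
  apply: open_nbhs_nbhs; split; [exact: chart_codom_open|by exists x].
have icx : \forall q \near cmap c x, O (cinv c q).
  apply: (chart_inv_continuous cc dx); rewrite (chart_cancel cc dx).
  exact: open_nbhs_nbhs.
rewrite /interior; near=> q.
have [y dy yq] : (cmap c @` dom c) q by near: q.
exists y => //; split=> //; rewrite -(chart_cancel cc dy) yq.
by near: q.
Unshelve. all: by end_near. Qed.

Lemma prod_is_chart (V W : normedModType R) (S T : topologicalType)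
    (c : chart V S) (c' : chart W T) :
  is_chart c -> is_chart c' -> is_chart (prod_chart c c').
Proof.
move=> cc cc'; split=> /=.
- by apply: open_setX; exact: chart_dom_open.
- rewrite (_ : _ @` _ = (cmap c @` dom c) `*` (cmap c' @` dom c')).
    by apply: open_setX; exact: chart_codom_open.
  apply/seteqP; split=> [_ [[x y] [/= dx dy] <-]|[_ _] [/= [x dx <-] [y dy <-]]].
    by split; [exists x|exists y].
  by exists (x, y).
- by move=> [x y] [/= dx dy]; rewrite !chart_cancel.
- move=> [x y] [/= dx dy].
  apply: cvg_pair; apply: (@continuous_comp _ _ _ _ (cmap _)) => /=.
  + exact: cvg_fst.
  + exact: chart_continuous.
  + exact: cvg_snd.
  + exact: chart_continuous.
- move=> [x y] [/= dx dy].
  apply: cvg_pair; apply: (@continuous_comp _ _ _ _ (cinv _)) => /=.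
  + exact: cvg_fst.
  + exact: chart_inv_continuous.
  + exact: cvg_snd.
  + exact: chart_inv_continuous.
Qed.

Lemma smooth_map_differentiable (V W : normedModType R)
    (S T : topologicalType) (A : charted V S) (B : charted W T) (F : S -> T)
    (c : chart V S) (c' : chart W T) (x : S) : smooth_map A B F ->
  atlas A c -> atlas B c' -> dom c x -> dom c' (F x) ->
  differentiable (cmap c' \o F \o cinv c) (cmap c x).
Proof.
move=> [_ sF] Ac Bc' dx dFx; have [dF _] := sF _ _ Ac Bc' 1%N.
by apply: dF; exists x.
Qed.

End charts.

(** * Curves through the identity of a Lie group, and their conjugates *)

Section lie_group.
Context (R : realType) (d : nat) (G : ptopologicalGroupType).
Variables (A : charted 'rV[R]_d G) (expG : 'rV[R]_d -> G).
Hypotheses (lieG : is_lie_group A) (exp_spec : is_exponential A expG).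
Local Notation c1 := (chart_at A 1%g).
Local Notation v1 := (cmap c1 1%g).

(** Derivatives along orbits depend only on the velocity at the identity, so any such curve may
    stand in for exp(tX). In particular g exp(tX) g^-1 never has to be recognised as the exponential
    of Ad(g) X. *)
Definition tangent_curve (gam : R -> G) (X : 'rV[R]_d) : Prop :=
  [/\ {for 0, continuous gam}, gam 0 = 1%g & is_derive (0 : R) (1 : R) (cmap c1 \o gam) X].

Lemma lie_chart_at g : atlas A (chart_at A g) /\ dom (chart_at A g) g.
Proof. exact: mfd_chart_at (lie_manifold lieG) g. Qed.

Lemma lie_chart c : atlas A c -> is_chart c.
Proof. exact: mfd_chart (lie_manifold lieG) c. Qed.

Lemma tangent_curve_exp X : tangent_curve (fun t => expG (t *: X)) X.
Proof.
have [sc _ e0 vX] := exp_spec X.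
have e0' : expG (0 *: X) = 1%g by rewrite scale0r.
split=> //; first by case: sc => + _; apply.
have dc : differentiable (cmap c1 \o (fun t => expG (t *: X))) 0.
  have [Ac dc1] := lie_chart_at 1%g.
  by apply: (smooth_map_differentiable (c := Chart setT id id) sc);
    rewrite //= e0'.
apply: DeriveDef; first exact: diff_derivable.
by rewrite -derive1E -[RHS]vX /velocity e0'.
Qed.

(** Smoothness of the product is known only between charts, so conjugation is factored as a left
    multiplication read in the chart at [g], followed by a right multiplication back into the chart
    at 1. The factorisation holds near [v1], where [g * y] stays in the domain of the chart at
    [g]. *)
Lemma differentiable_conj g :
  differentiable (cmap c1 \o (fun y => (g * y * g^-1)%g) \o cinv c1) v1.
Proof.
have [Ac1 dc1] := lie_chart_at 1%g.
have [Acg dcg] := lie_chart_at g; set cg := chart_at A g in Acg dcg.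
have [Aci dci] := lie_chart_at g^-1%g; set ci := chart_at A g^-1%g in Aci dci.
pose m1 := cmap cg \o (fun p : G * G => (p.1 * p.2)%g) \o
  cinv (prod_chart cg c1).
pose m2 := cmap c1 \o (fun p : G * G => (p.1 * p.2)%g) \o
  cinv (prod_chart cg ci).
have dm1 : differentiable m1 (cmap cg g, v1).
  apply: (smooth_map_differentiable (x := (g, 1%g)) (lie_mul lieG)) => //=.
    by exists cg, c1.
  by rewrite mulg1.
have dm2 : differentiable m2 (cmap cg g, cmap ci g^-1%g).
  apply: (smooth_map_differentiable (x := (g, g^-1%g)) (lie_mul lieG)) => //=.
    by exists cg, ci.
  by rewrite mulgV.
pose k1 v := m1 (cmap cg g, v).
have k1v1 : k1 v1 = cmap cg g.
  rewrite /k1 /m1 /= (chart_cancel (lie_chart Acg))//.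
  by rewrite (chart_cancel (lie_chart Ac1))// mulg1.
have dk1 : differentiable k1 v1.
  have dp := differentiable_pairr (cmap cg g) v1.
  exact: (differentiable_comp dp dm1).
have dk : differentiable (fun v => m2 (k1 v, cmap ci g^-1%g)) v1.
  have dp := differentiable_pair dk1 (differentiable_cst (cmap ci g^-1%g) v1).
  by apply: (differentiable_comp dp); rewrite /= k1v1.
apply: near_eq_differentiable dk.
have cm : continuous (fun p : G * G => (p.1 * p.2)%g) := (lie_mul lieG).1.
have cgy : {for v1, continuous (fun v => (g * cinv c1 v)%g)}.
  apply: (@continuous_comp _ _ _ (fun v => (g, cinv c1 v))
           (fun p : G * G => (p.1 * p.2)%g)); last exact: cm.
  by apply: continuous_pair; [exact: cst_continuous|exact: (chart_inv_continuous
    (lie_chart Ac1) dc1)].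
have ncg : \forall v \near v1, dom cg (g * cinv c1 v)%g.
  apply: cgy; rewrite (chart_cancel (lie_chart Ac1))// mulg1.
  apply: open_nbhs_nbhs; split=> //; exact: chart_dom_open (lie_chart Acg).
near=> v; rewrite /k1 /m2 /m1 /= (chart_cancel (lie_chart Acg) dcg).
rewrite (chart_cancel (lie_chart Acg))//; last by near: v.
by rewrite (chart_cancel (lie_chart Aci)).
Unshelve. all: by end_near. Qed.

(** The target chart in [Ad_mx] is the preferred chart at [g * 1 * g^-1], which becomes the chart at
    1 only after simplifying that product. *)
Lemma Ad_mxE g : Ad_mx A g =
  jacobian (cmap c1 \o (fun y => (g * y * g^-1)%g) \o cinv c1) v1.
Proof. by rewrite /Ad_mx /tangent_mx mulg1 mulgV. Qed.

Lemma tangent_curve_conj gam X g : tangent_curve gam X ->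
  tangent_curve (fun t => (g * gam t * g^-1)%g) (X *m Ad_mx A g).
Proof.
move=> [cgam gam0 [dgam DgamE]]; have [Ac1 dc1] := lie_chart_at 1%g.
have cm : continuous (fun p : G * G => (p.1 * p.2)%g) := (lie_mul lieG).1.
split; last 2 first.
- by rewrite gam0 mulg1 mulgV.
- set K := cmap c1 \o (fun y => (g * y * g^-1)%g) \o cinv c1.
  have dK : differentiable K ((cmap c1 \o gam) 0).
    by rewrite /= gam0; exact: differentiable_conj.
  have {}dgam : differentiable (cmap c1 \o gam) 0 by apply/derivable1_diffP.
  have dKgam : differentiable (K \o (cmap c1 \o gam)) 0.
    exact: differentiable_comp.
  apply: (@near_eq_is_derive _ _ _ (K \o (cmap c1 \o gam))).
    have ndom : \forall t \near 0, dom c1 (gam t).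
      apply: cgam; rewrite gam0; apply: open_nbhs_nbhs; split=> //.
      exact: chart_dom_open (lie_chart Ac1).
    near=> t; rewrite /K /= (chart_cancel (lie_chart Ac1))//.
    by near: t.
  apply: DeriveDef; first exact: diff_derivable.
  rewrite (deriveE _ dKgam) (diff_comp dgam dK) /= -(deriveE _ dgam) DgamE.
  have dKg := differentiable_conj g.
  by rewrite gam0 Ad_mxE -(deriveEjacobian _ dKg) (deriveE _ dKg).
- apply: (@continuous_comp _ _ _ (fun t => ((g * gam t)%g, g^-1%g))
           (fun p : G * G => (p.1 * p.2)%g)); last exact: cm.
  apply: continuous_pair; last exact: cst_continuous.
  apply: (@continuous_comp _ _ _ (fun t => (g, gam t))
           (fun p : G * G => (p.1 * p.2)%g)); last exact: cm.
  by apply: continuous_pair => //; exact: cst_continuous.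
Unshelve. all: by end_near. Qed.

End lie_group.

(** * Derivatives along orbits *)

Section homogeneous.
Context (R : realType) (d n : nat) (G : ptopologicalGroupType)
  (M : ptopologicalType).
Variables (A : charted 'rV[R]_d G) (B : charted 'rV[R]_n M).
Variables (act : G -> M -> M) (expG : 'rV[R]_d -> G).
Hypotheses (hom : is_homogeneous A B act) (exp_spec : is_exponential A expG).
Local Notation c1 := (chart_at A 1%g).
Local Notation v1 := (cmap c1 1%g).
Implicit Types (f : M -> R) (c : chart 'rV[R]_n M) (X : 'rV[R]_d).

Let lieG := hom_group hom.

(** One chart [c] serves as source and target, since only group elements near 1 matter. In this form
    the set is verbatim the domain on which smoothness of the action is stated. *)
Definition action_dom c : set ('rV[R]_d * 'rV[R]_n) :=
  cmap (prod_chart c1 c) @` (dom (prod_chart c1 c) `&`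
    (fun p : G * M => act p.1 p.2) @^-1` dom c).

Definition action_fun f c (p : 'rV[R]_d * 'rV[R]_n) : R :=
  f (act (cinv c1 p.1) (cinv c p.2)).

Lemma mfd_chartP c : atlas B c -> is_chart c.
Proof. exact: mfd_chart (hom_manifold hom) c. Qed.

Lemma act_continuous : continuous (fun p : G * M => act p.1 p.2).
Proof. exact: (hom_act_smooth hom).1. Qed.

Lemma actr_continuous g : continuous (act g).
Proof.
move=> x; apply: (@continuous_comp _ _ _ (fun y => (g, y))
  (fun p : G * M => act p.1 p.2)); last exact: act_continuous.
by apply: continuous_pair => //; exact: cst_continuous.
Qed.

Lemma action_dom_open c : atlas B c -> open (action_dom c).
Proof.
move=> Bc; have [Ac1 _] := lie_chart_at lieG 1%g.
apply: chart_image_open.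
  by apply: prod_is_chart; [exact: lie_chart lieG _ Ac1|exact: mfd_chartP].
apply: open_comp; first by move=> p _; exact: act_continuous.
exact: chart_dom_open (mfd_chartP Bc).
Qed.

Lemma action_dom1 c x : dom c x -> action_dom c (v1, cmap c x).
Proof.
move=> dx; exists (1%g, x) => //; split=> /=; last by rewrite (hom_act1 hom).
by split=> //; have [] := lie_chart_at lieG 1%g.
Qed.

Lemma smooth_action_fun f c k : smooth_fun B f -> atlas B c ->
  Ck k (action_dom c) (action_fun f c).
Proof.
move=> [_ sf] Bc; have [Ac1 _] := lie_chart_at lieG 1%g.
have cc := mfd_chartP Bc; have oU := action_dom_open Bc.
have sfc := sf _ _ Bc erefl k.
have sact := (hom_act_smooth hom).2 (prod_chart c1 c) c.
have {}sact := sact (ex_intro _ c1 (ex_intro _ c (And3 Ac1 Bc erefl))) Bc k.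
apply: (eq_Ck oU) (Ck_comp oU _ sact sfc).
- move=> _ [[g x] [[/= dg dx] dgx] <-] /=.
  by rewrite /action_fun /= (chart_cancel cc)// (chart_cancel cc dx)
    (chart_cancel (lie_chart lieG Ac1)).
- move=> _ [[g x] [[/= dg dx] dgx] <-] /=.
  exists (act g x) => //.
  by rewrite (chart_cancel cc dx) (chart_cancel (lie_chart lieG Ac1)).
Qed.

(** The value is a partial derivative in the group direction, where the curve enters only through
    [X]. Linearity of [Dop] in [X] and smoothness in the point are both read off from this
    expression. *)
Lemma is_derive_tangent_curve f c x gam X : smooth_fun B f -> atlas B c ->
  dom c x -> tangent_curve A gam X ->
  is_derive (0 : R) (1 : R) (fun t => f (act (gam t) x))
    ('D_(X, 0) (action_fun f c) (v1, cmap c x)).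
Proof.
move=> sf Bc dx [cgam gam0 [dgam DgamE]].
have [Ac1 dc1] := lie_chart_at lieG 1%g.
have cc := mfd_chartP Bc.
have [daf _] := smooth_action_fun 1 sf Bc.
have {}daf : differentiable (action_fun f c) (v1, cmap c x).
  exact/daf/action_dom1.
have {}dgam : differentiable (cmap c1 \o gam) 0 by apply/derivable1_diffP.
pose k t : 'rV[R]_d * 'rV[R]_n := ((cmap c1 \o gam) t, cmap c x).
have dcst := differentiable_cst (cmap c x) (0 : R).
have dk : differentiable k 0.
  exact: (differentiable_pair dgam dcst).
have k0 : k 0 = (v1, cmap c x) by rewrite /k /= gam0.
have kE : 'd k 0 1 = (X, 0).
  by rewrite (diff_pair dgam dcst) /= diff_cst -(deriveE _ dgam) DgamE.
have daf' : differentiable (action_fun f c) (k 0) by rewrite k0.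
have dfk : differentiable (action_fun f c \o k) 0.
  exact: differentiable_comp.
apply: (@near_eq_is_derive _ _ _ (action_fun f c \o k)).
  have ndom : \forall t \near 0, dom c1 (gam t).
    apply: cgam; rewrite gam0; apply: open_nbhs_nbhs; split=> //.
    exact: chart_dom_open (lie_chart lieG Ac1).
  near=> t; rewrite /action_fun /= (chart_cancel cc dx).
  by rewrite (chart_cancel (lie_chart lieG Ac1))//; near: t.
apply: DeriveDef; first exact: diff_derivable.
rewrite (deriveE _ dfk) (diff_comp dk daf') [LHS]/= kE k0.
by rewrite (deriveE _ daf).
Unshelve. all: by end_near. Qed.

Lemma DopE f c x X : smooth_fun B f -> atlas B c -> dom c x ->
  Dop act expG X f x = 'D_(X, 0) (action_fun f c) (v1, cmap c x).
Proof.
move=> sf Bc dx; rewrite /Dop derive1E.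
have [] := is_derive_tangent_curve sf Bc dx
  (tangent_curve_exp lieG exp_spec X) => _ ->//.
Qed.

Lemma mfd_chart_atP x : atlas B (chart_at B x) /\ dom (chart_at B x) x.
Proof. exact: mfd_chart_at (hom_manifold hom) x. Qed.

Lemma is_derive_Dop f x gam X : smooth_fun B f -> tangent_curve A gam X ->
  is_derive (0 : R) (1 : R) (fun t => f (act (gam t) x)) (Dop act expG X f x).
Proof.
move=> sf tg; have [Bc dx] := mfd_chart_atP x.
by rewrite (DopE _ sf Bc dx); exact: is_derive_tangent_curve.
Qed.

Lemma Dop_linear f x a X Y : smooth_fun B f ->
  Dop act expG (a *: X + Y) f x =
  a * Dop act expG X f x + Dop act expG Y f x.
Proof.
move=> sf; have [Bc dx] := mfd_chart_atP x.
have [daf _] := smooth_action_fun 1 sf Bc.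
have {}daf := daf _ (action_dom1 dx).
rewrite !(DopE _ sf Bc dx) !(deriveE _ daf).
have -> : (a *: X + Y, 0 : 'rV[R]_n) = a *: (X, 0) + (Y, 0).
  by rewrite -[RHS]/(a *: X + Y, a *: (0 : 'rV[R]_n) + 0) scaler0 addr0.
by rewrite linearP.
Qed.

(** In a chart, [Dop] is the slice at the identity of a directional derivative of [action_fun]; one
    order of differentiability is spent, so order k for the derivative uses order k+1 for [f]. *)
Lemma smooth_Dop f X : smooth_fun B f -> smooth_fun B (Dop act expG X f).
Proof.
move=> sf; split.
  move=> x; have [Bc dx] := mfd_chart_atP x; set c := chart_at B x in Bc dx.
  have cc := mfd_chartP Bc.
  have [_ /(_ (X, 0)) Daf] := smooth_action_fun 1 sf Bc.
  have cD : {for x, continuous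
      (fun y => 'D_(X, 0) (action_fun f c) (v1, cmap c y))}.
    apply: (@continuous_comp _ _ _ (fun y => (v1, cmap c y))
      ('D_(X, 0) (action_fun f c))); last exact: Daf _ (action_dom1 dx).
    by apply: continuous_pair; [exact: cst_continuous|exact: chart_continuous].
  rewrite /prop_for /continuous_at (DopE _ sf Bc dx).
  apply: cvg_trans cD; apply: near_eq_cvg.
  have ndom : \forall y \near x, dom c y.
    by apply: open_nbhs_nbhs; split=> //; exact: chart_dom_open cc.
  by near=> y; rewrite (DopE _ sf Bc)//; near: y.
move=> c _ Bc -> k; rewrite /= preimage_setT setIT.
have cc := mfd_chartP Bc.
have [_ /(_ (X, 0)) Daf] := smooth_action_fun k.+1 sf Bc.
have := Ck_pairr v1 (action_dom_open Bc) Daf.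
move=> /(@Ck_sub _ _ _ _ _ (cmap c @` dom c)) Dafr.
apply: (eq_Ck (chart_codom_open cc)) (Dafr _).
- by move=> _ [x dx <-] /=; rewrite (chart_cancel cc dx) (DopE _ sf Bc dx).
- by move=> _ [x dx <-] /=; exact: action_dom1.
Unshelve. all: by end_near. Qed.

End homogeneous.

(** * Invariance of the Casimir operator *)

Section bilinear_trace.
Context (R : realType) (d : nat).
Implicit Types b : 'rV[R]_d -> 'rV[R]_d -> R.

Definition bilinear_form b : Prop :=
  (forall v a u w, b (a *: u + w) v = a * b u v + b w v) /\
  (forall u a v w, b u (a *: v + w) = a * b u v + b u w).

Let form_mx b : 'M[R]_d := \matrix_(i, j) b (delta_mx 0 i) (delta_mx 0 j).

Lemma linear_row_sum (l : 'rV[R]_d -> R) :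
  (forall a u w, l (a *: u + w) = a * l u + l w) ->
  forall u, l u = \sum_i u 0 i * l (delta_mx 0 i).
Proof.
move=> ll u.
have l0 : l 0 = 0 by have := ll 1 0 0; rewrite scaler0 addr0 mul1r; lra.
rewrite [X in l X]row_sum_delta; apply: (big_ind2 (fun x y => l x = y)) => //.
- by move=> x1 x2 y1 y2 <- <-; rewrite -[x1]scale1r ll mul1r scale1r.
- by move=> i _; rewrite -[_ *: _]addr0 ll l0 addr0.
Qed.

Lemma bilinear_form_mx b : bilinear_form b -> forall u v,
  b u v = (u *m form_mx b *m v^T) 0 0.
Proof.
move=> [bl br] u v; rewrite (linear_row_sum (bl v) u) -mulmxA mxE.
apply: eq_bigr => i _; congr (_ * _); rewrite mxE.
rewrite (linear_row_sum (br _) v); apply: eq_bigr => j _.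
by rewrite !mxE mulrC.
Qed.

(** With V the matrix of rows [X i] and P that of [p], orthonormality reads V P V^T = 1. A one-sided
    inverse of a square matrix is two-sided, so V^T V is the inverse of P, whatever the orthonormal
    family. *)
Lemma orthonormal_gram p (X : 'I_d -> 'rV[R]_d) : bilinear_form p ->
  (forall i j, p (X i) (X j) = (i == j)%:R) ->
  form_mx p *m ((\matrix_i X i)^T *m \matrix_i X i) = 1%:M.
Proof.
move=> bp pX; rewrite mulmxA; apply: mulmx1C; rewrite mulmxA; apply/matrixP => i j.
rewrite [RHS]mxE -[RHS]pX (bilinear_form_mx bp) !mxE.
apply: eq_bigr => k _; rewrite !mxE; congr (_ * _).
by apply: eq_bigr => l _; rewrite !mxE.
Qed.

(* Both sums are the trace of b against the inverse Gram matrix of p. *)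
Lemma sum_orthonormal b p (X Y : 'I_d -> 'rV[R]_d) :
  bilinear_form b -> bilinear_form p ->
  (forall i j, p (X i) (X j) = (i == j)%:R) ->
  (forall i j, p (Y i) (Y j) = (i == j)%:R) ->
  \sum_j b (X j) (X j) = \sum_j b (Y j) (Y j).
Proof.
move=> bb bp pX pY.
have trE (Z : 'I_d -> 'rV[R]_d) : \sum_j b (Z j) (Z j) =
    \tr (form_mx b *m ((\matrix_i Z i)^T *m \matrix_i Z i)).
  rewrite mulmxA mxtrace_mulC mulmxA; apply: eq_bigr => j _.
  rewrite (bilinear_form_mx bb) !mxE; apply: eq_bigr => k _.
  rewrite !mxE; congr (_ * _).
  by apply: eq_bigr => l _; rewrite !mxE.
have gX := orthonormal_gram bp pX; have gY := orthonormal_gram bp pY.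
rewrite !trE; congr (\tr (_ *m _)).
by rewrite -[LHS]mul1mx -(mulmx1C gY) -mulmxA gX mulmx1.
Qed.

Lemma polar_bilinear (Q : 'rV[R]_d -> R) :
  is_quadratic_form Q -> bilinear_form (polar Q).
Proof.
move=> Qq; have pl v a u w := quad_polar Qq v a u w.
have pC u v : polar Q u v = polar Q v u by rewrite /polar [u + v]addrC addrAC.
split=> [v a u w|u a v w]; first exact: pl.
by rewrite pC pl !(pC u).
Qed.

End bilinear_trace.

(** * Derivations, translations, and invariance of the operator *)

Section casimir.
Context (R : realType) (d n : nat) (G : ptopologicalGroupType)
  (M : ptopologicalType).
Variables (A : charted 'rV[R]_d G) (B : charted 'rV[R]_n M).
Variables (act : G -> M -> M) (expG : 'rV[R]_d -> G).
Hypotheses (hom : is_homogeneous A B act) (exp_spec : is_exponential A expG).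
Implicit Types (f : M -> R) (X : 'rV[R]_d).
Local Notation Dop := (Dop act expG).

Definition exp_derivable X f : Prop :=
  forall x, derivable (fun t : R => f (act (expG (t *: X)) x)) (0 : R) (1 : R).

(* The C^1 functions, seen through the one-parameter subgroups only. *)
Definition C1_exp f : Prop :=
  continuous f /\ forall X, exp_derivable X f /\ continuous (Dop X f).

Lemma smooth_exp_derivable X f : smooth_fun B f -> exp_derivable X f.
Proof.
move=> sf x; have [] := is_derive_Dop hom exp_spec x sf
  (tangent_curve_exp (hom_group hom) exp_spec X); by [].
Qed.

Lemma smooth_C1 f : smooth_fun B f -> C1_exp f.
Proof.
move=> sf; split=> [|X]; first exact: sf.1.
split; first exact: smooth_exp_derivable.
by have [] := smooth_Dop hom exp_spec X sf.
Qed.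

Lemma DopD X f g x : exp_derivable X f -> exp_derivable X g ->
  Dop X (fun y => f y + g y) x = Dop X f x + Dop X g x.
Proof. by move=> df dg; rewrite /Defs.Dop !derive1E -deriveD//. Qed.

Lemma DopZ X a f x : exp_derivable X f ->
  Dop X (fun y => a * f y) x = a * Dop X f x.
Proof. by move=> df; rewrite /Defs.Dop !derive1E -[RHS]deriveZ//. Qed.

Lemma exp0 X : expG (0 *: X) = 1%g.
Proof. by have [_ _ e0 _] := exp_spec X; rewrite scale0r. Qed.

Lemma DopM X f g x : exp_derivable X f -> exp_derivable X g ->
  Dop X (fun y => f y * g y) x = f x * Dop X g x + g x * Dop X f x.
Proof.
move=> df dg; rewrite /Defs.Dop !derive1E.
have := deriveM (df x) (dg x); rewrite exp0 (hom_act1 hom) => <-.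
by [].
Qed.

Lemma exp_derivableZ X a f : exp_derivable X f ->
  exp_derivable X (fun y => a * f y).
Proof. by move=> df x; apply: derivableZ. Qed.

Lemma exp_derivableM X f g : exp_derivable X f -> exp_derivable X g ->
  exp_derivable X (fun y => f y * g y).
Proof. by move=> df dg x; apply: derivableM. Qed.

Lemma C1M f g : C1_exp f -> C1_exp g -> C1_exp (fun y => f y * g y).
Proof.
move=> [cf Df] [cg Dg]; split=> [x|X].
  by apply: continuousM; [exact: cf|exact: cg].
have [df cDf] := Df X; have [dg cDg] := Dg X.
split; first exact: exp_derivableM.
rewrite (_ : Dop X _ = fun x => f x * Dop X g x + g x * Dop X f x).
  move=> x.
  exact: (continuousD (continuousM (cf x) (cDg x)) (continuousM (cg x) (cDf x))).
by apply/funext => x; rewrite DopM.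
Qed.

(** By the one-parameter law, the difference quotient at time [t] from [x] is the difference
    quotient at time 0 from the moved point. *)
Lemma is_derive_flow X f x (t : R) : exp_derivable X f ->
  is_derive t (1 : R) (fun s : R => f (act (expG (s *: X)) x))
    (Dop X f (act (expG (t *: X)) x)).
Proof.
move=> df; have dft := df (act (expG (t *: X)) x).
have E : (fun h : R => h^-1 *: (((fun s : R => f (act (expG (s *: X)) x))
        \o shift t) (h *: 1) - f (act (expG (t *: X)) x))) =
    (fun h : R => h^-1 *: (((fun s : R => f (act (expG (s *: X))
      (act (expG (t *: X)) x))) \o shift 0) (h *: 1) -
      f (act (expG (0 *: X)) (act (expG (t *: X)) x)))).
  apply/funext => h /=; rewrite addr0 exp0 (hom_act1 hom) -(hom_actM hom).
  by have [_ -> _ _] := exp_spec X.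
apply: DeriveDef; first by rewrite /derivable E.
by rewrite /derive E /Defs.Dop derive1E.
Qed.

(** Since g exp(tX) = (g exp(tX) g^-1) g, the curve is the orbit of [act g x] under a curve of
    velocity [X *m Ad_mx A g]. *)
Lemma is_derive_translate X f g x : smooth_fun B f ->
  is_derive (0 : R) (1 : R) (fun t : R => f (act g (act (expG (t *: X)) x)))
    (Dop (X *m Ad_mx A g) f (act g x)).
Proof.
move=> sf; have tg := tangent_curve_exp (hom_group hom) exp_spec X.
have := is_derive_Dop hom exp_spec (act g x) sf
  (tangent_curve_conj (hom_group hom) g tg).
rewrite (_ : (fun t : R => _) =
  (fun t : R => f (act g (act (expG (t *: X)) x))))//.
apply/funext => t.
by rewrite -!(hom_actM hom) -!mulgA mulVg mulg1.
Qed.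

Lemma Dop_translate X f g : smooth_fun B f ->
  Dop X (f \o act g) = Dop (X *m Ad_mx A g) f \o act g.
Proof.
move=> sf; apply/funext => x; rewrite /Defs.Dop derive1E.
by have [_ ->] := is_derive_translate X g x sf.
Qed.

Lemma C1_translate f g : smooth_fun B f -> C1_exp (f \o act g).
Proof.
move=> sf; have cg : continuous (act g) by exact: (actr_continuous hom).
split=> [x|X].
  by apply: continuous_comp; [exact: cg|exact: sf.1].
split; first by move=> x; have [] := is_derive_translate X g x sf.
rewrite (Dop_translate _ _ sf) => x; apply: continuous_comp; first exact: cg.
by have [cD _] := smooth_Dop hom exp_spec (X *m Ad_mx A g) sf; exact: cD.
Qed.

(** Bilinearity is what makes the sum of second derivatives a trace, independent of the orthonormal
    basis. *)
Lemma Dop2_bilinear f x : smooth_fun B f ->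
  bilinear_form (fun X Y => Dop X (Dop Y f) x).
Proof.
move=> sf; split=> [Y a X X'|X a Y Y'].
  by apply: (Dop_linear hom exp_spec) => //; exact: (smooth_Dop hom exp_spec).
have sD Z := smooth_Dop hom exp_spec Z sf.
rewrite (_ : Dop (a *: Y + Y') f = fun y => a * Dop Y f y + Dop Y' f y).
  rewrite DopD ?DopZ//; first exact: smooth_exp_derivable.
    by apply: exp_derivableZ; exact: smooth_exp_derivable.
  exact: smooth_exp_derivable.
by apply/funext => y; rewrite (Dop_linear hom exp_spec).
Qed.

Variables (Q : 'rV[R]_d -> R) (X : 'I_d -> 'rV[R]_d).
Hypotheses (Q_inv : is_invariant_form A Q) (X_on : is_orthonormal_family Q X).
Local Notation Lop := (Lop act expG X).

Lemma LopE f x : Lop f x = - \sum_j Dop (X j) (Dop (X j) f) x.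
Proof. by []. Qed.

(** Translation by [g] replaces each [X j] by [X j *m Ad_mx A g]. Invariance of [Q] keeps the family
    orthonormal, and [sum_orthonormal] identifies the two sums. *)
Lemma Lop_translate f g x : smooth_fun B f -> Lop (f \o act g) x = Lop f (act g x).
Proof.
move=> sf; have sD Z := smooth_Dop hom exp_spec Z sf.
have E j : Dop (X j) (Dop (X j) (f \o act g)) x =
    Dop (X j *m Ad_mx A g) (Dop (X j *m Ad_mx A g) f) (act g x).
  by rewrite (Dop_translate _ _ sf) (Dop_translate _ _ (sD _)).
rewrite [LHS]LopE.
rewrite [RHS]LopE.
transitivity (- \sum_j Dop (X j *m Ad_mx A g)
  (Dop (X j *m Ad_mx A g) f) (act g x)).
  by apply: (congr1 -%R); apply: eq_bigr => j _; exact: E.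
apply: (congr1 -%R).
apply: (sum_orthonormal (Dop2_bilinear (act g x) sf)
  (polar_bilinear (inv_form_quadratic Q_inv))) => // i j.
by rewrite -X_on /polar -mulmxDl !(inv_form_Ad Q_inv).
Qed.

End casimir.

(** * Integration of continuous functions *)

Section continuous_integration.
Context (R : realType) (M : ptopologicalType).
Variable mu : {finite_measure set (borel M) -> \bar R}.
Hypothesis cptM : compact [set: M].
Implicit Types f g : M -> R.

Definition Rint f : R := Rintegral mu [set: borel M] f.

Lemma continuous_borel_measurable f : continuous f ->
  measurable_fun [set: borel M] (f : borel M -> R).
Proof.
move=> /continuousP cf; apply: (measurability _ (RGenOpens.measurableE R)).
move=> _ [_ [a [b ->] <-]]; rewrite setTI; apply: sub_sigma_algebra.
exact/cf/interval_open.
Qed.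

Lemma continuous_bounded f : continuous f ->
  exists2 C, 0 <= C & forall x, `|f x| <= C.
Proof.
move=> cf; have [] := @compact_bounded R R (f @` setT).
  by apply: continuous_compact => //; exact: continuous_subspaceT.
move=> C [_ fC]; exists (`|C| + 1); first by rewrite addr_ge0.
move=> x; apply: (fC (`|C| + 1)); last by exists x.
by rewrite ltr_pwDr// ler_norm.
Qed.

Lemma measurable_bounded_fun_integrable f C :
  measurable_fun [set: borel M] (f : borel M -> R) ->
  (forall x, `|f x| <= C) -> mu.-integrable [set: borel M] (EFin \o f).
Proof.
move=> mf fC; apply: measurable_bounded_integrable => //.
  by rewrite ltey_eq fin_num_measure.
by exists C; split; [exact: num_real|move=> y Cy x _ /=; rewrite (le_trans (fC x))// ltW].
Qed.

Lemma continuous_integrable f : continuous f ->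
  mu.-integrable [set: borel M] (EFin \o f).
Proof.
move=> cf; have [C _ fC] := continuous_bounded cf.
by apply: measurable_bounded_fun_integrable fC; exact: continuous_borel_measurable.
Qed.

Lemma EFin_cint f : continuous f ->
  (Rint f)%:E = (\int[mu]_(x in [set: borel M]) (f x)%:E)%E.
Proof.
by move=> cf; rewrite /Rint /Rintegral fineK//; apply: integrable_fin_num => //;
  exact: continuous_integrable.
Qed.

Lemma cintD f g : continuous f -> continuous g ->
  Rint (fun x => f x + g x) = Rint f + Rint g.
Proof. by move=> cf cg; rewrite /Rint RintegralD//; exact: continuous_integrable. Qed.

Lemma cintZ a f : continuous f -> Rint (fun x => a * f x) = a * Rint f.
Proof. by move=> cf; rewrite /Rint RintegralZl//; exact: continuous_integrable. Qed.

Lemma continuous_fun_sum (I : Type) (r : seq I) (F : I -> M -> R) :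
  (forall i, continuous (F i)) -> continuous (fun x => \sum_(i <- r) F i x).
Proof.
move=> cF; elim: r => [|i r IH] x.
  rewrite (_ : (fun x => _) = cst 0); first exact: cst_continuous.
  by apply/funext => y; rewrite big_nil.
rewrite (_ : (fun x => _) = F i + (fun x => \sum_(i <- r) F i x)).
  exact: (continuousD (cF i x) (IH x)).
by apply/funext => y; rewrite big_cons.
Qed.

Lemma cint_sum (I : Type) (r : seq I) (F : I -> M -> R) :
  (forall i, continuous (F i)) ->
  Rint (fun x => \sum_(i <- r) F i x) = \sum_(i <- r) Rint (F i).
Proof.
move=> cF; elim: r => [|i r IH].
  rewrite big_nil -[RHS](mul0r (Rint (cst 0))) -cintZ; last exact: cst_continuous.
  by congr Rint; apply/funext => x; rewrite big_nil mul0r.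
rewrite big_cons -IH -cintD//; last exact: continuous_fun_sum.
by congr Rint; apply/funext => x; rewrite big_cons.
Qed.

Lemma continuous_funM f g : continuous f -> continuous g ->
  continuous (fun x => f x * g x).
Proof. by move=> cf cg x; exact: (continuousM (cf x) (cg x)). Qed.

Lemma continuous_funD f g : continuous f -> continuous g ->
  continuous (fun x => f x + g x).
Proof. by move=> cf cg x; exact: (continuousD (cf x) (cg x)). Qed.

Lemma continuous_funZ a f : continuous f -> continuous (fun x => a * f x).
Proof. by move=> cf; apply: continuous_funM => // x; exact: cst_continuous. Qed.

(** * Full support of an invariant measure *)

Section invariance.
Context (G : Type) (act : G -> M -> M).
Hypotheses (act_cont : forall g : G, continuous (act g))
  (act_trans : forall x y, exists g : G, act g x = y)
  (mu_inv : invariant_measure act mu).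

Lemma act_measurable (g : G) :
  measurable_fun [set: borel M] (act g : borel M -> borel M).
Proof.
apply: (@measurability _ _ (borel M) (borel M) setT (act g) (@open M)) => //.
move=> _ [U oU <-]; rewrite setTI; apply: sub_sigma_algebra.
by move/continuousP: (@act_cont g); apply.
Qed.

Lemma cint_act f (g : G) : continuous f -> Rint (f \o act g) = Rint f.
Proof.
move=> cf; rewrite /Rint /Rintegral; congr fine.
rewrite -(@integral_pushforward _ _ (borel M) (borel M) R (act g)
  (act_measurable g) mu setT (EFin \o f))//.
- apply: eq_measure_integral; first exact: (act_measurable g).
  by move=> mg E mE _; exact: mu_inv.
- by apply/measurable_EFinP; exact: (continuous_borel_measurable cf).
- rewrite preimage_setT; apply: (@continuous_integrable (f \o act g)) => x.
  by apply: continuous_comp; [exact: act_cont|exact: cf].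
Qed.

Hypothesis mu_neq0 : mu [set: borel M] != 0%E.

(** The translates of a null open set are null; by transitivity they cover [M] as soon as one point
    is in the set, and by compactness finitely many suffice, so the whole space would be null. *)
Lemma open_measure_gt0 (O : set M) : open O -> O !=set0 -> mu O != 0%E.
Proof.
move=> oO [x Ox]; apply/negP => /eqP muO; move/negP: mu_neq0; apply.
pose g y := sval (cid (act_trans y x)).
have gE y : act (g y) y = x by rewrite /g; case: cid.
have oF y : open (act (g y) @^-1` O).
  by move/continuousP: (@act_cont (g y)); apply.
have mF y : measurable (act (g y) @^-1` O : set (borel M)).
  exact: sub_sigma_algebra.
have mu0 y : mu.-negligible (act (g y) @^-1` O : set (borel M)).
  apply/(negligibleP _ (mF y)).
  by rewrite -[RHS]muO; apply: mu_inv; exact: sub_sigma_algebra.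
have := cptM; rewrite compact_cover.
move=> /(_ M setT (fun y => act (g y) @^-1` O)) [//|y _|D _ sD].
  by exists y => //=; rewrite gE.
have neg (s : seq M) : mu.-negligible
    (\big[setU/set0]_(y <- s) (act (g y) @^-1` O : set (borel M))).
  elim: s => [|y s IH]; first by rewrite big_nil; exact: negligible_set0.
  by rewrite big_cons; exact: negligibleU.
have : mu.-negligible [set: borel M].
  apply: negligibleS (neg (finmap.enum_fset D)) => y /sD [z zD zy].
  by rewrite -bigcup_seq; exists z.
by move/(negligibleP _ measurableT) => ->.
Qed.

Lemma continuous_cint_eq0 f : continuous f -> (forall x, 0 <= f x) ->
  Rint f = 0 -> forall x, f x = 0.
Proof.
move=> cf f0 intf x; apply/eqP/negPn/negP => fx0.
have oO : open [set y | f y != 0].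
  by move/continuousP: cf => /(_ [set z | z != 0]); apply; exact: open_neq.
have /negP := open_measure_gt0 oO (ex_intro _ x fx0); apply.
have mf : measurable_fun [set: borel M] (EFin \o f : borel M -> \bar R).
  by apply/measurable_EFinP; exact: (continuous_borel_measurable cf).
have : (\int[mu]_(y in [set: borel M]) `|(EFin \o f) y| = 0)%E.
  rewrite -[RHS](congr1 EFin intf) EFin_cint//.
  by apply: eq_integral => y _ /=; rewrite ger0_norm.
move=> /(ae_eq_integral_abs mu measurableT mf) [Z [mZ muZ sZ]].
rewrite -measure_le0 -muZ le_measure// ?inE//; first exact: sub_sigma_algebra.
by move=> y /= /eqP fy; apply: sZ => /(_ I) [].
Qed.

End invariance.
End continuous_integration.

(** * Skewness of the derivations *)

Section complex_facts.
Context (R : realType).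
Implicit Types (z w : R[i]) (r : R).

Lemma sqr_normc z : Normc.normc z ^+ 2 = complex.Re z ^+ 2 + complex.Im z ^+ 2.
Proof. by case: z => a b /=; rewrite sqr_sqrtr// addr_ge0// sqr_ge0. Qed.

Lemma mulC_conjC_r r s : (r%:C * conjc s%:C = (r * s)%:C)%C.
Proof. by rewrite /conjc /= oppr0 -rmorphM. Qed.

End complex_facts.

Section spectral.
Context (R : realType) (d n : nat) (G : ptopologicalGroupType)
  (M : ptopologicalType).
Variables (A : charted 'rV[R]_d G) (B : charted 'rV[R]_n M).
Variables (act : G -> M -> M) (expG : 'rV[R]_d -> G).
Hypotheses (hom : is_homogeneous A B act) (exp_spec : is_exponential A expG).
Variable mu : {finite_measure set (borel M) -> \bar R}.
Hypothesis mu_inv : invariant_measure act mu.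
Implicit Types (f g h : M -> R).
Local Notation Dop := (Dop act expG).
Local Notation C1 := (C1_exp act expG).
Local Notation cint := (Rint mu).

Let cptM : compact [set: M] := hom_manifold_compact hom.

Definition real_ip f g : R := cint (fun x => f x * g x).

Lemma ipC f g : real_ip f g = real_ip g f.
Proof. by congr cint; apply/funext => x; rewrite mulrC. Qed.

Lemma ip_sumr (I : Type) (r : seq I) f (F : I -> M -> R) (c : I -> R) :
  continuous f -> (forall i, continuous (F i)) ->
  real_ip f (fun x => \sum_(i <- r) c i * F i x) = \sum_(i <- r) c i * real_ip f (F i).
Proof.
move=> cf cF.
transitivity (cint (fun x => \sum_(i <- r) c i * (f x * F i x))).
  by congr cint; apply/funext => x; rewrite mulr_sumr; apply: eq_bigr => i _; rewrite mulrCA.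
rewrite (cint_sum mu cptM); last first.
  by move=> i; apply: continuous_funZ; exact: continuous_funM.
by apply: eq_bigr => i _; rewrite (cintZ mu cptM)//; exact: continuous_funM.
Qed.

Lemma C1_Dop_continuous X f : C1 f -> continuous (Dop X f).
Proof. by move=> [_ /(_ X)[]]. Qed.

Lemma C1_derivable X f : C1 f -> exp_derivable act expG X f.
Proof. by move=> [_ /(_ X)[]]. Qed.

(** Differentiation under the integral sign: the derivative at any time is [Dop X f] at a moved
    point times [h], and compactness bounds it by a constant uniform in time. The interval from -1
    to 1 is an arbitrary neighbourhood of 0. *)
Lemma is_derive_cint_flow X f h : C1 f -> continuous h ->
  is_derive (0 : R) (1 : R)
    (fun t : R => cint (fun x => f (act (expG (t *: X)) x) * h x))
    (cint (fun x => Dop X f x * h x)).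
Proof.
move=> Cf ch; have df := C1_derivable (X := X) Cf; have cDf := C1_Dop_continuous (X := X) Cf.
pose F (t : R) (x : borel M) : R := f (act (expG (t *: X)) x) * h x.
have dF t x : is_derive t (1 : R) (F ^~ x) (Dop X f (act (expG (t *: X)) x) * h x).
  have [dft Dft] := is_derive_flow hom exp_spec x t df.
  have dF : derivable (F ^~ x) t 1.
    exact: (derivableM dft (derivable_cst (h x) t 1)).
  apply: DeriveDef => //.
  rewrite (deriveM dft (derivable_cst (h x) t 1)) Dft derive_cst scaler0 add0r.
  by rewrite /GRing.scale/= mulrC.
have [C1 C1ge0 DfC] := continuous_bounded cptM cDf.
have [C2 C2ge0 hC] := continuous_bounded cptM ch.
have cflow t : continuous (act (expG (t *: X))) by exact: (actr_continuous hom).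
have intF t : mu.-integrable [set: borel M] (EFin \o F t).
  apply: (continuous_integrable mu cptM); apply: continuous_funM => // x.
  by apply: continuous_comp; [exact: cflow|case: Cf => + _; apply].
have itv0 : `](-1 : R), 1[%classic 0 by rewrite /= in_itv/= ltrN10 ltr01.
have derF t x : `](-1 : R), 1[%classic t -> [set: borel M] x ->
    derivable (F ^~ x) t 1 by move=> _ _; have [] := dF t x.
have cC : mu.-integrable [set: borel M] (EFin \o (fun=> C1 * C2)).
  by apply: (continuous_integrable mu cptM) => x; exact: cst_continuous.
have ub t x : `](-1 : R), 1[%classic t -> [set: borel M] x ->
    `|partial1of2 F t x| <= C1 * C2.
  move=> _ _; rewrite partial1of2E; have [_ ->] := dF t x.
  by rewrite normrM ler_pM.
have C12 (x : borel M) : 0 <= C1 * C2 by rewrite mulr_ge0.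
have der := @derivable_under_integral R _ _ mu F setT measurableT 0 (-1) 1 itv0
  (fun t _ => intF t) derF _ C12 cC ub.
have Der := @differentiation_under_integral R _ _ mu F setT measurableT 0 (-1) 1
  itv0 (fun t _ => intF t) derF _ C12 cC ub.
apply: DeriveDef; first exact: der.
rewrite -derive1E Der; apply: eq_Rintegral => x _.
by rewrite partial1of2E; have [_ ->] := dF 0 x; rewrite (exp0 exp_spec) (hom_act1 hom).
Qed.

Lemma cint_translate f (g : G) : continuous f -> cint (f \o act g) = cint f.
Proof.
by apply: (cint_act cptM _ mu_inv) => g'; exact: (actr_continuous hom).
Qed.

(** By invariance of the measure, the integral of [f] composed with exp(tX) does not depend on [t];
    its derivative at 0 is the integral in question. *)
Lemma cint_Dop X f : C1 f -> cint (Dop X f) = 0.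
Proof.
move=> Cf; have c1 : continuous (cst 1 : M -> R) by exact: cst_continuous.
have [_] := is_derive_cint_flow X Cf c1.
rewrite (_ : (fun t : R => _) = cst (cint f)).
  rewrite derive_cst => ->; congr cint; apply/funext => x; exact/esym/mulr1.
apply/funext => t; rewrite -(cint_translate (expG (t *: X)) Cf.1).
by congr cint; apply/funext => x; exact: mulr1.
Qed.

Lemma Dop_skew X f g : C1 f -> C1 g -> real_ip (Dop X f) g = - real_ip f (Dop X g).
Proof.
move=> Cf Cg; have := cint_Dop X (C1M hom exp_spec Cf Cg).
have [df dg] := (C1_derivable (X := X) Cf, C1_derivable (X := X) Cg).
rewrite (_ : Dop X _ = fun x => f x * Dop X g x + Dop X f x * g x); last first.
  by apply/funext => x; rewrite (DopM hom exp_spec)// [g x * _]mulrC.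
have cDf := C1_Dop_continuous (X := X) Cf; have cDg := C1_Dop_continuous (X := X) Cg.
rewrite (cintD mu cptM); first by rewrite addrC => /eqP; rewrite addr_eq0 => /eqP.
  by apply: continuous_funM => //; exact: Cf.1.
by apply: continuous_funM => //; exact: Cg.1.
Qed.

Variables (X : 'I_d -> 'rV[R]_d).
Local Notation Lop := (Lop act expG X).

Lemma ip_Lop f g : C1 f -> (forall j, C1 (Dop (X j) f)) -> C1 g ->
  real_ip (Lop f) g = \sum_j real_ip (Dop (X j) f) (Dop (X j) g).
Proof.
move=> Cf CDf Cg.
have -> : real_ip (Lop f) g =
    real_ip g (fun x => \sum_j (-1) * Dop (X j) (Dop (X j) f) x).
  rewrite ipC; congr (real_ip g _); apply/funext => x.
  by rewrite LopE -mulr_sumr mulN1r.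
rewrite ip_sumr; [|exact: Cg.1|by move=> j; exact: C1_Dop_continuous].
by apply: eq_bigr => j _; rewrite mulN1r ipC Dop_skew// opprK.
Qed.

(** Both sides equal the Dirichlet form of [ip_Lop], which is symmetric. *)
Lemma Lop_sym f g : C1 f -> (forall j, C1 (Dop (X j) f)) ->
  C1 g -> (forall j, C1 (Dop (X j) g)) -> real_ip (Lop f) g = real_ip f (Lop g).
Proof.
move=> Cf CDf Cg CDg; rewrite (ip_Lop Cf CDf Cg) [RHS]ipC (ip_Lop Cg CDg Cf).
by apply: eq_bigr => j _; exact: ipC.
Qed.

End spectral.

(** * Eigenvalues of a sum of double commutators *)

Section commutator_bound.
Context (R : realType) (d K : nat).
Implicit Types (P S T : 'M[R]_K).

Lemma mxtrace_mul_tr m (P : 'M[R]_(m, K)) :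
  \tr (P *m P^T) = \sum_i \sum_j P i j ^+ 2.
Proof.
by apply: eq_bigr => i _; rewrite mxE; apply: eq_bigr => j _; rewrite mxE.
Qed.

Lemma mxtrace_mul_tr_ge0 P : 0 <= \tr (P *m P^T).
Proof. by rewrite mxtrace_mul_tr; do 2!apply: sumr_ge0 => ? _; exact: sqr_ge0. Qed.

Lemma mxtrace_mul_tr_eq0 P : \tr (P *m P^T) = 0 -> P = 0.
Proof.
rewrite mxtrace_mul_tr => /eqP; rewrite psumr_eq0; last first.
  by move=> i _; apply: sumr_ge0 => j _; exact: sqr_ge0.
move=> /allP P0; apply/matrixP => i j; rewrite mxE.
have := P0 i (mem_index_enum i); rewrite implyTb psumr_eq0; last first.
  by move=> k _; exact: sqr_ge0.
by move=> /allP /(_ j (mem_index_enum j)); rewrite implyTb sqrf_eq0 => /eqP.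
Qed.

Lemma mxtrace_mulBB P S : \tr ((P - S) *m (P - S)^T) <=
  2 * \tr (P *m P^T) + 2 * \tr (S *m S^T).
Proof.
rewrite !mxtrace_mul_tr !mulr_sumr -big_split /=; apply: ler_sum => i _.
rewrite !mulr_sumr -big_split /=; apply: ler_sum => j _; rewrite !mxE.
have := sqr_ge0 (P i j + S i j); nra.
Qed.

Lemma mxtrace_diag_le (e : 'rV[R]_K) (om : R) P :
  (forall i, e 0 i <= om) -> \tr (diag_mx e *m (P *m P^T)) <= om * \tr (P *m P^T).
Proof.
move=> eom; rewrite /mxtrace mulr_sumr; apply: ler_sum => i _.
rewrite mul_diag_mx mxE ler_wpM2r// mxE; apply: sumr_ge0 => j _.
by rewrite mxE -expr2 sqr_ge0.
Qed.

Lemma commutator_eigenvalue (A : 'I_d -> 'M[R]_K) (e : 'rV[R]_K) (om tau : R) T :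
  (forall k, (A k)^T = - A k) -> \sum_k A k *m (A k)^T = diag_mx e ->
  (forall i, e 0 i <= om) -> 4 * om < tau ->
  tau *: T = - \sum_k (A k *m (A k *m T - T *m A k) -
                       (A k *m T - T *m A k) *m A k) ->
  T = 0.
Proof.
move=> Aa Ae eom omtau TE; apply: mxtrace_mul_tr_eq0; apply/eqP.
rewrite eq_le mxtrace_mul_tr_ge0 andbT.
(* As tau - 4 om > 0, this inequality forces the squared norm of [T] to be at most 0. *)
suff : tau * \tr (T *m T^T) <= 4 * om * \tr (T *m T^T).
  by rewrite -subr_le0 -mulrBl pmulr_rle0// subr_gt0.
have -> : tau * \tr (T *m T^T) = \sum_k \tr ((A k *m T - T *m A k) *m
    (A k *m T - T *m A k)^T).
  rewrite -mxtraceZ scalemxAl TE mulNmx mulmx_suml -sumrN linear_sum.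
  apply: eq_bigr => k _; set C := A k *m T - T *m A k.
  (* For skew [A k], taking the commutator with [A k] commutes with transposition; cyclicity of the
     trace then moves the outer commutator onto [T^T]. *)
  have -> : C^T = A k *m T^T - T^T *m A k.
    by rewrite /C linearB /= !trmx_mul Aa mulmxN mulNmx opprK addrC.
  have trC : \tr (A k *m C *m T^T) = \tr (C *m (T^T *m A k)).
    by rewrite -mulmxA mxtrace_mulC -mulmxA.
  have trB P S : \tr (P - S) = \tr P - \tr S by rewrite linearB.
  clearbody C; rewrite /= mulmxBl opprB mulmxBr trB [RHS]trB trC.
  by rewrite !mulmxA.
apply: le_trans (ler_sum _ (fun k _ => mxtrace_mulBB _ _)) _.
rewrite big_split /= -!mulr_sumr.
(* Cyclicity brings the two factors [A k] together, and their sum over [k] is the diagonal matrix.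
   Left multiplication leaves [T *m T^T] beside it, right multiplication [T^T *m T]. *)
have -> : \sum_k \tr (A k *m T *m (A k *m T)^T) = \tr (diag_mx e *m (T *m T^T)).
  rewrite -Ae mulmx_suml linear_sum; apply: eq_bigr => k _.
  rewrite /= trmx_mul !Aa !(mulmxN, mulNmx) !(linearN mxtrace); congr (- _).
  rewrite -!mulmxA [LHS]mxtrace_mulC [RHS]mxtrace_mulC -!mulmxA.
  by rewrite [RHS]mxtrace_mulC -!mulmxA.
have -> : \sum_k \tr (T *m A k *m (T *m A k)^T) = \tr (diag_mx e *m (T^T *m T)).
  rewrite -Ae mulmx_suml linear_sum; apply: eq_bigr => k _.
  by rewrite /= trmx_mul -!mulmxA mxtrace_mulC -!mulmxA.
have := mxtrace_diag_le T eom; have := mxtrace_diag_le T^T eom.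
rewrite trmxK (mxtrace_mulC T^T) => h1 h2; nra.
Qed.

End commutator_bound.

(** * Products of eigenfunctions *)

Section eigenfunctions.
Context (R : realType) (d n : nat) (G : ptopologicalGroupType)
  (M : ptopologicalType).
Variables (A : charted 'rV[R]_d G) (B : charted 'rV[R]_n M).
Variables (act : G -> M -> M) (expG : 'rV[R]_d -> G).
Hypotheses (hom : is_homogeneous A B act) (exp_spec : is_exponential A expG).
Variable mu : {finite_measure set (borel M) -> \bar R}.
Hypothesis mu_inv : invariant_measure act mu.
Variables (Q : 'rV[R]_d -> R) (X : 'I_d -> 'rV[R]_d).
Hypotheses (Q_inv : is_invariant_form A Q) (X_on : is_orthonormal_family Q X).
Variables (ev : nat -> R) (u : nat -> M -> R).
Hypothesis eig : is_eigenbasis B act expG X mu ev u.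
Implicit Types (f g h v : M -> R).
Local Notation Dop := (Dop act expG).
Local Notation C1 := (C1_exp act expG).
Local Notation cint := (Rint mu).
Local Notation ip := (real_ip mu).
Local Notation Lop := (Lop act expG X).

Let cptM : compact [set: M] := hom_manifold_compact hom.

Lemma u_smooth m : smooth_fun B (u m). Proof. exact: eig_smooth eig m. Qed.

Lemma u_continuous m : continuous (u m). Proof. exact: (u_smooth m).1. Qed.

Lemma u_C1 m : C1 (u m).
Proof. exact: (smooth_C1 hom exp_spec) (u_smooth m). Qed.

Lemma Du_smooth Y m : smooth_fun B (Dop Y (u m)).
Proof. exact: (smooth_Dop hom exp_spec) (u_smooth m). Qed.

Lemma Du_C1 Y m : C1 (Dop Y (u m)).
Proof. exact: (smooth_C1 hom exp_spec) (Du_smooth Y m). Qed.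

Lemma inner_real f g :
  inner mu (fun x => (f x)%:C%C) (fun x => (g x)%:C%C) = (ip f g)%:C%C.
Proof.
rewrite /inner /cintegral.
under [X in Complex (Rintegral _ _ X) _]eq_fun do rewrite mulC_conjC_r.
under [X in Complex _ (Rintegral _ _ X)]eq_fun do rewrite mulC_conjC_r.
congr Complex; rewrite /Rintegral (_ : (fun x => _) = cst 0%E) ?integral0//.
Qed.

Lemma ip_u m m' : ip (u m) (u m') = (m == m')%:R.
Proof.
have [_ /(_ m m') on _] := eig_basis eig.
by move: on; rewrite inner_real => /(congr1 (@complex.Re R)) /= ->; case: eqP.
Qed.

Lemma mu_neq0 : mu [set: borel M] != 0%E.
Proof.
apply/negP => /eqP mu0; have /eqP := ip_u 0 0; rewrite eqxx eq_sym.
suff -> : ip (u 0) (u 0) = 0 by rewrite oner_eq0.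
rewrite /real_ip /Rint /Rintegral null_set_integral//.
apply/measurable_EFinP; apply: continuous_borel_measurable.
by apply: continuous_funM; exact: u_continuous.
Qed.

Lemma continuous_eq0 f : continuous f -> cint (fun x => f x ^+ 2) = 0 ->
  forall x, f x = 0.
Proof.
move=> cf f20 x; have cf2 : continuous (fun x => f x ^+ 2).
  by apply: continuous_funM.
have act_cont (g : G) : continuous (act g) by exact: (actr_continuous hom).
have := continuous_cint_eq0 cptM act_cont (hom_transitive hom) mu_inv mu_neq0
  cf2 (fun x => sqr_ge0 _) f20 x.
by move/eqP; rewrite sqrf_eq0 => /eqP.
Qed.

(** The remainders are stationary from [K] on and tend to 0 in norm, so the remainder at [K] has
    norm 0; being continuous, it vanishes at every point and not merely almost everywhere. *)
Lemma continuous_span_u K v : continuous v ->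
  (forall m, (K <= m)%N -> ip v (u m) = 0) ->
  forall x, v x = \sum_(m < K) ip v (u m) * u m x.
Proof.
move=> cv vK; pose w k x := v x - \sum_(m < k) ip v (u m) * u m x.
have cw k : continuous (w k).
  rewrite /w; under eq_fun do rewrite -mulN1r.
  apply: continuous_funD => //; apply: continuous_funZ.
  apply: continuous_fun_sum => i; apply: continuous_funZ; exact: u_continuous.
have wE k : norm2 mu (fun x => (v x)%:C%C - \sum_(m < k)
    inner mu (fun x => (v x)%:C%C) (fun x => (u m x)%:C%C) * (u m x)%:C%C) =
    (cint (fun x => w k x ^+ 2))%:E.
  rewrite (EFin_cint mu cptM); last by apply: continuous_funM; exact: cw.
  rewrite /norm2; apply: eq_integral => x _; rewrite sqr_normc.
  under eq_bigr do rewrite inner_real -rmorphM.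
  by rewrite -rmorph_sum -rmorphB /= expr0n /= addr0.
have wK k : (K <= k)%N -> w k = w K.
  move=> Kk; apply/funext => x; congr (_ - _).
  rewrite -(subnKC Kk) big_split_ord /= [X in _ + X]big1 ?addr0// => i _.
  by rewrite vK ?mul0r// leq_addr.
have L2v : L2 mu (fun x => (v x)%:C%C).
  split => /=.
  - exact: continuous_borel_measurable.
  - exact: measurable_cst.
  - rewrite /norm2; under eq_integral do rewrite sqr_normc /= expr0n /= addr0.
    rewrite -(EFin_cint mu cptM) ?ltry//; exact: continuous_funM.
have [_ _ /(_ _ L2v) lim0] := eig_basis eig.
have {}lim0 : (fun k => (cint (fun x => w k x ^+ 2))%:E) @ \oo --> 0%E.
  by move: lim0; under eq_fun do rewrite wE.
have w0 : cint (fun x => w K x ^+ 2) = 0.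
  suff : (fun k => (cint (fun x => w k x ^+ 2))%:E) @ \oo -->
      (cint (fun x => w K x ^+ 2))%:E.
    by move=> /(cvg_unique (@ereal_hausdorff R) lim0)[].
  apply: cvg_near_cst; near=> k; rewrite wK//.
  by near: k; exact: nbhs_infty_ge.
move=> x; apply/eqP; rewrite -subr_eq0.
by apply/eqP; exact: (continuous_eq0 (cw K) w0).
Unshelve. all: by end_near. Qed.

Lemma Lop_u m : Lop (u m) = fun x => ev m * u m x.
Proof. by apply/funext => x; exact: eig_eq eig m x. Qed.

(** The translate is again an eigenfunction for [ev i], and symmetry of the operator separates
    distinct eigenvalues. The translate is handled in the class [C1_exp], which suffices for that
    symmetry. *)
Lemma u_translate_orth (g : G) i m : ev i != ev m -> ip (u i \o act g) (u m) = 0.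
Proof.
move=> evim; set v := u i \o act g.
have Cv : C1 v by exact: (C1_translate hom exp_spec) (u_smooth i).
have CDv j : C1 (Dop (X j) v).
  rewrite (Dop_translate hom exp_spec _ _ (u_smooth i)).
  exact: (C1_translate hom exp_spec) (Du_smooth _ i).
have := Lop_sym hom exp_spec mu_inv Cv CDv (u_C1 m) (fun j => Du_C1 (X j) m).
rewrite Lop_u (_ : Lop v = fun x => ev i * v x); last first.
  apply/funext => x; rewrite (Lop_translate hom exp_spec Q_inv X_on)//.
    by rewrite Lop_u.
  exact: u_smooth.
have cvu : continuous (fun x => v x * u m x).
  by apply: continuous_funM; [exact: Cv.1|exact: u_continuous].
have El : ip (fun x => ev i * v x) (u m) = ev i * ip v (u m).
  rewrite -(cintZ mu cptM)//; congr cint; apply/funext => x; exact/esym/mulrA.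
have Er : ip v (fun x => ev m * u m x) = ev m * ip v (u m).
  rewrite -(cintZ mu cptM)//; congr cint; apply/funext => x; exact: mulrCA.
rewrite El Er.
by move/eqP; rewrite -subr_eq0 -mulrBl mulf_eq0 subr_eq0 (negbTE evim) => /eqP.
Qed.

(** The integral is the derivative at 0 of the inner product of [u m] with the translates of [u i],
    a function that is identically 0. *)
Lemma Du_orth Y i m : ev i != ev m -> ip (Dop Y (u i)) (u m) = 0.
Proof.
move=> evim; rewrite /real_ip.
have [_ <-] := is_derive_cint_flow hom exp_spec mu Y (u_C1 i) (@u_continuous m).
rewrite (_ : (fun t : R => _) = cst 0) ?derive_cst//.
by apply/funext => t; exact: u_translate_orth.
Qed.

(** Since the eigenvalues are ordered and unbounded, spectral conditions become initial segments of
    indices, which makes matrices over ['I_K] available. *)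
Lemma spectral_cutoff (om : R) : exists K, forall m, (ev m <= om) = (m < K)%N.
Proof.
have : \forall m \near \oo, om < ev m.
  by move/cvgryPgt: (ev_cvg eig); apply.
move=> [K0 _ K0P].
have exK : exists m, om < ev m by exists K0; apply: K0P => /=.
exists (ex_minn exK); case: ex_minnP => K omK Kmin m.
rewrite leNgt; case: (ltnP m K) => [mK|Km].
  by apply/negP => /Kmin; rewrite leqNgt mK.
by rewrite (lt_le_trans omK) ?(ev_le eig).
Qed.

Lemma cint_Lop f : (forall j, C1 (Dop (X j) f)) -> cint (Lop f) = 0.
Proof.
move=> CDf; have -> : Lop f =
    fun x => \sum_j (-1) * Dop (X j) (Dop (X j) f) x.
  by apply/funext => x; rewrite LopE -mulr_sumr mulN1r.
have cD j : continuous (Dop (X j) (Dop (X j) f)).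
  exact: C1_Dop_continuous (CDf j).
rewrite (cint_sum mu cptM) => [|j]; last exact: continuous_funZ.
apply: big1 => j _; rewrite (cintZ mu cptM)//.
by rewrite (cint_Dop hom exp_spec mu_inv _ (CDf j)) mulr0.
Qed.

(** The operator maps into functions of integral 0, and [u m] is a multiple of its own image because
    its eigenvalue is positive. *)
Lemma cint_u m : (0 < m)%N -> cint (u m) = 0.
Proof.
move=> m0; have := cint_Lop (fun j => Du_C1 (X j) m).
rewrite Lop_u (cintZ mu cptM); last exact: u_continuous.
have evm : 0 < ev m by rewrite (lt_le_trans (ev_1 eig))// (ev_le eig).
by move/eqP; rewrite mulf_eq0 gt_eqF//= => /eqP.
Qed.

(** By [cint_u] the constant 1 is orthogonal to every later eigenfunction, so its pointwise
    expansion reduces to a multiple of [u 0]. *)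
Lemma u0_constant : exists2 c, c != 0 & forall x, u 0 x = c.
Proof.
have c1 : continuous (cst 1 : M -> R) by exact: cst_continuous.
have orth m : (1 <= m)%N -> ip (cst 1) (u m) = 0.
  move=> m0; rewrite -(cint_u m0); congr cint; apply/funext => x; exact: mul1r.
have E x : 1 = ip (cst 1) (u 0) * u 0 x.
  by have := continuous_span_u c1 orth x; rewrite big_ord1.
have c0 : ip (cst 1) (u 0) != 0.
  by apply/eqP => c0; have /eqP := E point; rewrite c0 mul0r oner_eq0.
exists (ip (cst 1) (u 0))^-1; first by rewrite invr_eq0.
by move=> x; apply: (mulfI c0); rewrite -E mulfV.
Qed.

(** For d = 0 the operator is an empty sum, hence 0, whereas [u 1] is a unit vector with positive
    eigenvalue. Positivity of d gives 4 <= 4 d in the band of the cubature formula. *)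
Lemma dim_gt0 : (0 < d)%N.
Proof.
rewrite lt0n; apply/negP => /eqP d0.
have u10 : u 1 = cst 0.
  apply/funext => x; have /eqP := eig_eq eig 1 x.
  rewrite LopE big1 ?oppr0; last first.
    by move=> j; case/negP: (negbT (ltn0 j)); rewrite -[X in (_ < X)%N]d0.
  by rewrite eq_sym mulf_eq0 gt_eqF ?(ev_1 eig)//= => /eqP.
have /eqP := ip_u 1 1; rewrite u10 /real_ip.
rewrite (_ : (fun _ => _) = (fun x => 0 * cst 0 x)); last first.
  by apply/funext => x; rewrite mul0r.
rewrite (cintZ mu cptM); last exact: cst_continuous.
by rewrite mul0r eq_sym oner_eq0.
Qed.

Lemma ip_Lopl f h : continuous h -> (forall j, C1 (Dop (X j) f)) ->
  ip (Lop f) h = - \sum_j ip (Dop (X j) (Dop (X j) f)) h.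
Proof.
move=> ch CDf.
have -> : ip (Lop f) h = ip h (fun x => \sum_j (-1) * Dop (X j) (Dop (X j) f) x).
  rewrite [LHS]ipC; congr (ip h _); apply/funext => x.
  by rewrite LopE -mulr_sumr mulN1r.
rewrite (ip_sumr hom mu _ _ ch); last first.
  by move=> j; exact: C1_Dop_continuous (CDf j).
rewrite -mulr_sumr mulN1r; congr (- _).
by apply: eq_bigr => j _; exact: ipC.
Qed.

Lemma ipDr f g h : continuous f -> continuous g -> continuous h ->
  ip f (fun x => g x + h x) = ip f g + ip f h.
Proof.
move=> cf cg ch; rewrite -(cintD mu cptM); try exact: continuous_funM.
by congr cint; apply/funext => x; rewrite mulrDr.
Qed.

Lemma ip_mul_u i j m om : ev i <= om -> ev j <= om -> 4 * om < ev m ->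
  ip (fun x => u i x * u j x) (u m) = 0.
Proof.
have [K KP] := spectral_cutoff om.
rewrite !KP => iK jK omm.
(* Row [i] lists the coefficients of the derivative of [u i] along [X k]; [DE] below shows that
   indices under [K] exhaust them. *)
pose Dm k : 'M[R]_K := \matrix_(i, l) ip (Dop (X k) (u i)) (u l).
pose T f : 'M[R]_K := \matrix_(i, j) ip f (fun x => u i x * u j x).
have cuu (p q : nat) : continuous (fun x => u p x * u q x).
  by apply: continuous_funM; exact: u_continuous.
have Cuu (p q : nat) : C1 (fun x => u p x * u q x).
  by apply: (C1M hom exp_spec); exact: u_C1.
(* An index q >= K has ev q > om >= ev p, so [Du_orth] kills the coefficient and the expansion stops
   at [K]. *)
have DE k (p : 'I_K) x : Dop (X k) (u p) x = \sum_l Dm k p l * u l x.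
  rewrite (@continuous_span_u K (Dop (X k) (u p))).
  - by apply: eq_bigr => l _; rewrite mxE.
  - exact: C1_Dop_continuous (u_C1 p).
  - move=> q Kq; apply: Du_orth; rewrite lt_eqF// (@le_lt_trans _ _ om)//.
      by rewrite KP.
    by rewrite ltNge KP -leqNgt.
have Aa k : (Dm k)^T = - Dm k.
  apply/matrixP => p q; rewrite !mxE (Dop_skew hom exp_spec mu_inv)//; last first.
  - exact: u_C1.
  - exact: u_C1.
  by rewrite ipC.
have AA : \sum_k Dm k *m (Dm k)^T = diag_mx (\row_(i < K) ev i).
  apply/matrixP => p q; rewrite !mxE summxE.
  transitivity (ip (Lop (u p)) (u q)); last first.
    rewrite Lop_u.
    have -> : ip (fun x => ev p * u p x) (u q) = ev p * ip (u p) (u q).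
      rewrite -(cintZ mu cptM); last exact: cuu.
      by congr cint; apply/funext => x; rewrite mulrA.
    by rewrite ip_u mulr_natr.
  rewrite (ip_Lop hom exp_spec mu_inv (u_C1 p) (fun k => Du_C1 (X k) p) (u_C1 q)).
  apply: eq_bigr => k _; rewrite mxE.
  have -> : Dop (X k) (u q) = fun x => \sum_l Dm k q l * u l x.
    by apply/funext => x; exact: DE.
  rewrite (ip_sumr hom mu).
  - by apply: eq_bigr => l _; rewrite [(Dm k)^T _ _]mxE [Dm k p l]mxE mulrC.
  - exact: C1_Dop_continuous (u_C1 p).
  - by move=> l; exact: u_continuous.
(* Skewness moves the derivative onto the product, Leibniz splits it between the two factors, and
   skewness of [Dm k] turns the sum of both terms into a commutator. *)
have TD k f : C1 f -> T (Dop (X k) f) = - (Dm k *m T f - T f *m Dm k).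
  move=> Cf; have -> : Dm k *m T f - T f *m Dm k = Dm k *m T f + T f *m (Dm k)^T.
    by rewrite Aa mulmxN.
  apply/matrixP => p q; rewrite !mxE.
  rewrite (Dop_skew hom exp_spec mu_inv (X k) Cf (Cuu p q)); congr (- _).
  have -> : Dop (X k) (fun x => u p x * u q x) = fun x =>
      \sum_l Dm k p l * (u l x * u q x) + \sum_l Dm k q l * (u p x * u l x).
    apply/funext => x; rewrite (DopM hom exp_spec).
    - rewrite !DE !mulr_sumr addrC; congr (_ + _); apply: eq_bigr => l _.
        by rewrite mulrC -mulrA.
      by rewrite mulrCA.
    - exact: C1_derivable (u_C1 p).
    - exact: C1_derivable (u_C1 q).
  have cf : continuous f := Cf.1.
  have cs (c : 'I_K -> R) (h : 'I_K -> M -> R) : (forall l, continuous (h l)) ->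
      continuous (fun x => \sum_l c l * h l x).
    by move=> ch; apply: continuous_fun_sum => l; exact: continuous_funZ.
  rewrite (ipDr cf); [|exact: cs|exact: cs].
  rewrite !(ip_sumr hom mu _ _ cf)//; congr (_ + _); apply: eq_bigr => l _.
    by rewrite !mxE.
  by rewrite !mxE mulrC.
suff : T (u m) = 0.
  move=> /matrixP /(_ (Ordinal iK) (Ordinal jK)); rewrite !mxE /=.
  by rewrite ipC.
have := @commutator_eigenvalue R d K Dm (\row_(i < K) ev i) om (ev m) (T (u m)) Aa AA.
apply => //; first by move=> p; rewrite mxE KP.
have CD k := Du_C1 (X k) m.
apply/matrixP => p q.
transitivity (ip (Lop (u m)) (fun x => u p x * u q x)).
  rewrite Lop_u !mxE -(cintZ mu cptM).
    by congr cint; apply/funext => x; rewrite mulrA.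
  by apply: continuous_funM => //; exact: u_continuous.
rewrite (ip_Lopl (cuu p q) CD) [RHS]mxE summxE; congr (- _).
apply: eq_bigr => k _.
(* The two signs produced by the two applications of [TD] cancel. *)
have -> : Dm k *m (Dm k *m T (u m) - T (u m) *m Dm k) -
  (Dm k *m T (u m) - T (u m) *m Dm k) *m Dm k = T (Dop (X k) (Dop (X k) (u m))).
  rewrite (TD _ _ (CD k)) (TD _ _ (u_C1 m)).
  by rewrite mulmxN mulNmx opprB opprK addrC.
by rewrite mxE.
Qed.

End eigenfunctions.

(** * Square integrable functions *)

Section square_integrable.
Context (R : realType) (M : ptopologicalType).
Variable mu : {finite_measure set (borel M) -> \bar R}.
Hypothesis cptM : compact [set: M].
Implicit Types (p q g h : M -> R) (F H : M -> R[i]).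
Local Notation cint := (Rint mu).
Local Notation intg p := (mu.-integrable [set: borel M] (EFin \o p)).

Lemma integrable_add p q : intg p -> intg q -> intg (fun x => p x + q x).
Proof. by move=> i j; exact: (integrableD measurableT i j). Qed.

Lemma integrable_scale a p : intg p -> intg (fun x => a * p x).
Proof. by move=> i; exact: (integrableZl measurableT a i). Qed.

Definition square_integrable p : Prop :=
  measurable_fun [set: borel M] (p : borel M -> R) /\ intg (fun x => p x ^+ 2).

Lemma square_integrableM p g : square_integrable p -> continuous g ->
  intg (fun x => p x * g x).
Proof.
move=> [mp ip2] cg; have [C C0 gC] := continuous_bounded cptM cg.
have mg := continuous_borel_measurable cg.
(* The majorant rests on |p| <= 1 + p^2, integrable because the measure is finite; [C] bounds the
   continuous factor. *)
apply: (@le_integrable _ _ _ mu setT measurableT _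
  (EFin \o (fun x => C * (1 + p x ^+ 2)))).
- by apply/measurable_EFinP; exact: measurable_funM.
- move=> x _; rewrite /= lee_fin.
  have p2 := sqr_ge0 (p x).
  rewrite [leRHS]ger0_norm; last by rewrite mulr_ge0// addr_ge0.
  rewrite normrM mulrC ler_pM// -real_normK ?num_real//.
  have := sqr_ge0 (`|p x| - 1); have := normr_ge0 (p x); nra.
- have i1 : intg (fun=> 1) by apply: (continuous_integrable mu cptM) => x; exact: cst_continuous.
  exact: (integrable_scale C (integrable_add i1 ip2)).
Qed.

Lemma RintD p q : intg p -> intg q -> cint (fun x => p x + q x) = cint p + cint q.
Proof. by move=> ? ?; exact: RintegralD. Qed.

Lemma RintZ a p : intg p -> cint (fun x => a * p x) = a * cint p.
Proof. by move=> ip; exact: RintegralZl. Qed.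

Lemma Rint_mul_sum p (I : Type) (r : seq I) (c : I -> R) (g : I -> M -> R) :
  square_integrable p -> (forall i, continuous (g i)) ->
  cint (fun x => p x * \sum_(i <- r) c i * g i x) =
  \sum_(i <- r) c i * cint (fun x => p x * g i x).
Proof.
move=> sp cg; elim: r => [|i r IH].
  rewrite big_nil -[RHS](mul0r (cint (fun x => p x * 0))) -RintZ.
    by congr cint; apply/funext => x; rewrite big_nil mulr0 mul0r.
  by apply: square_integrableM => // x; exact: cst_continuous.
rewrite big_cons -IH -RintZ; last exact: square_integrableM.
rewrite -RintD.
- by congr cint; apply/funext => x; rewrite big_cons mulrDr mulrCA.
- by apply: integrable_scale; exact: square_integrableM.
- apply: square_integrableM => //; apply: continuous_fun_sum => j.
  exact: continuous_funZ.
Qed.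

Lemma continuous_square_integrable g : continuous g -> square_integrable g.
Proof.
move=> cg; split; first exact: continuous_borel_measurable.
by apply: (continuous_integrable mu cptM); exact: continuous_funM.
Qed.

Lemma square_integrableB p g : square_integrable p -> continuous g ->
  square_integrable (fun x => p x - g x) /\
  cint (fun x => (p x - g x) ^+ 2) = cint (fun x => p x ^+ 2) -
    2 * cint (fun x => p x * g x) + cint (fun x => g x ^+ 2).
Proof.
move=> sp cg; have mg := continuous_borel_measurable cg.
have i1 := integrable_scale (-2) (square_integrableM sp cg).
have [_ i2] := continuous_square_integrable cg.
have i12 := integrable_add (integrable_add sp.2 i1) i2.
have E : (fun x => (p x - g x) ^+ 2) =
    (fun x => p x ^+ 2 + (-2) * (p x * g x) + g x ^+ 2).
  by apply/funext => x; ring.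
split; first split.
- by apply: measurable_funB => //; exact: sp.1.
- by rewrite E.
rewrite E RintD// ?RintD//; first by rewrite RintZ ?mulNr//; exact: square_integrableM.
- exact: sp.2.
- exact: integrable_add sp.2 i1.
Qed.

Lemma L2_square_integrable F : L2 mu F ->
  square_integrable (fun x => complex.Re (F x)) /\
  square_integrable (fun x => complex.Im (F x)).
Proof.
move=> [mRe mIm nF].
have key (p q : M -> R) : measurable_fun [set: borel M] (p : borel M -> R) ->
    measurable_fun [set: borel M] (q : borel M -> R) ->
    (\int[mu]_(x in [set: borel M]) (p x ^+ 2 + q x ^+ 2)%:E < +oo)%E ->
    intg (fun x => p x ^+ 2).
  move=> mp mq fin.
  have mp2 : measurable_fun [set: borel M] (fun x : borel M => (p x ^+ 2)%:E).
    by apply/measurable_EFinP; exact: measurable_funM.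
  have mq2 : measurable_fun [set: borel M] (fun x : borel M => (q x ^+ 2)%:E).
    by apply/measurable_EFinP; exact: measurable_funM.
  apply/integrableP; split=> //; apply: le_lt_trans fin.
  apply: ge0_le_integral => //.
  - exact: measurableT_comp.
  - under eq_fun do rewrite EFinD; exact: emeasurable_funD.
  - move=> x _; rewrite lee_fin ger0_norm ?sqr_ge0// lerDl sqr_ge0//.
split; split => //.
- apply: (key _ _ mRe mIm); move: nF; rewrite /norm2.
  by under eq_integral do rewrite sqr_normc.
- apply: (key _ _ mIm mRe); move: nF; rewrite /norm2.
  by under eq_integral do rewrite sqr_normc addrC.
Qed.

Lemma square_integrable_L2 F :
  square_integrable (fun x => complex.Re (F x)) ->
  square_integrable (fun x => complex.Im (F x)) -> L2 mu F.
Proof.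
move=> [mRe iRe] [mIm iIm]; split=> //; rewrite /norm2.
under eq_integral do rewrite sqr_normc.
have /integrableP[_] := integrable_add iRe iIm; apply: le_lt_trans.
by apply: (le_trans _ (le_abse_integral _ _ _)) => //;
  [exact: lee_abs|case/integrableP: (integrable_add iRe iIm)].
Qed.

Lemma norm2E F : L2 mu F -> norm2 mu F =
  (cint (fun x => complex.Re (F x) ^+ 2) +
   cint (fun x => complex.Im (F x) ^+ 2))%:E.
Proof.
move=> /L2_square_integrable[[_ iRe] [_ iIm]].
rewrite -RintD// /Rint /Rintegral fineK; last first.
  by apply: integrable_fin_num => //; exact: (integrable_add iRe iIm).
by apply: eq_integral => x _; rewrite sqr_normc.
Qed.

Lemma innerE F g h : L2 mu F -> continuous g -> continuous h ->
  inner mu F (fun x => Complex (g x) (h x)) =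
  Complex (cint (fun x => complex.Re (F x) * g x) +
           cint (fun x => complex.Im (F x) * h x))
          (cint (fun x => complex.Im (F x) * g x) -
           cint (fun x => complex.Re (F x) * h x)).
Proof.
move=> /L2_square_integrable[sRe sIm] cg ch; rewrite /inner /cintegral.
have iM p k (sp : square_integrable p) (ck : continuous k) :=
  square_integrableM sp ck.
congr Complex.
  rewrite -RintD; [|exact: iM|exact: iM]; congr cint; apply/funext => x.
  by case: (F x) => a b /=; rewrite mulrN opprK.
rewrite -mulN1r -RintZ; last exact: iM.
rewrite -RintD; [|exact: iM|by apply: integrable_scale; exact: iM].
congr cint; apply/funext => x.
by case: (F x) => a b /=; rewrite mulN1r mulrN addrC.
Qed.

End square_integrable.

(** * Sums of nonnegative extended reals *)

Section esum_facts.
Local Open Scope ereal_scope.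

Lemma esum_swap (R : realType) (T T' : choiceType) (a : T -> T' -> \bar R) :
  (forall i j, 0 <= a i j) ->
  \esum_(i in [set: T]) \esum_(j in [set: T']) a i j =
  \esum_(j in [set: T']) \esum_(i in [set: T]) a i j.
Proof.
move=> a0; rewrite !esum_esum//.
rewrite (@reindex_esum _ _ _ ([set: T'] `*`` (fun=> [set: T]))
  ([set: T] `*`` (fun=> [set: T'])) (fun k => (k.2, k.1)))//.
split=> [[i j]|[i j] [i' j'] _ _ /= [-> ->]|[i j] _]//.
by exists (j, i).
Qed.

(** Finite partial sums give one inequality for every nonnegative factor; the converse is the same
    inequality for the inverse factor and the scaled family. The factor 0 is apart, the sum being
    possibly infinite. *)
Lemma esumZl (R : realType) (T : choiceType) (S : set T) (c : R)
    (a : T -> \bar R) : (0 <= c)%R -> (forall i, 0 <= a i) ->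
  \esum_(i in S) (c%:E * a i) = c%:E * \esum_(i in S) a i.
Proof.
have le (r : R) (b : T -> \bar R) : (0 <= r)%R -> (forall i, 0 <= b i) ->
    \esum_(i in S) (r%:E * b i) <= r%:E * \esum_(i in S) b i.
  move=> r0 b0; rewrite ge_ereal_sup => //= _ [Y [finY YS]] <-.
  rewrite -ge0_mule_fsumr// lee_wpmul2l//.
  by apply: esum_ge; exists Y.
rewrite le_eqVlt => /predU1P[<- a0|c0 a0].
  by rewrite mul0e esum1// => i _; rewrite mul0e.
apply/eqP; rewrite eq_le le ?(ltW c0)//=.
have ca0 i : 0 <= c%:E * a i by rewrite mule_ge0// lee_fin ltW.
have := le c^-1%R (fun i => c%:E * a i); rewrite invr_ge0 (ltW c0).
move=> /(_ isT ca0).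
under eq_esum do rewrite muleA -EFinM mulVf ?gt_eqF// mul1e.
move=> H; have := lee_wpmul2l (_ : 0 <= c%:E) H.
rewrite lee_fin (ltW c0) => /(_ isT).
by rewrite muleA -EFinM mulfV ?gt_eqF// mul1e.
Qed.

Lemma esum_ord (R : realType) (K : nat) (a : nat -> \bar R) :
  (forall i, 0 <= a i) -> (forall i, (K <= i)%N -> a i = 0) ->
  \esum_(i in [set: nat]) a i = \sum_(i < K) a i.
Proof.
move=> a0 aK; rewrite fsbig_ord -esum_fset//.
rewrite [RHS]esum_mkcond; apply: eq_esum => i _; case: ifPn => //.
by rewrite notin_setE /= => /negP; rewrite -leqNgt => /aK.
Qed.

End esum_facts.

(** * The frame *)

Section frame.
Context (R : realType) (d n : nat) (G : ptopologicalGroupType)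
  (M : ptopologicalType).
Variables (A : charted 'rV[R]_d G) (B : charted 'rV[R]_n M).
Variables (act : G -> M -> M) (expG : 'rV[R]_d -> G).
Hypotheses (hom : is_homogeneous A B act) (exp_spec : is_exponential A expG).
Variable mu : {finite_measure set (borel M) -> \bar R}.
Hypothesis mu_inv : invariant_measure act mu.
Variables (Q : 'rV[R]_d -> R) (X : 'I_d -> 'rV[R]_d).
Hypotheses (Q_inv : is_invariant_form A Q) (X_on : is_orthonormal_family Q X).
Variables (ev : nat -> R) (u : nat -> M -> R).
Hypothesis eig : is_eigenbasis B act expG X mu ev u.
Implicit Types (F H : M -> R[i]) (z : nat -> R[i]).
Local Notation cint := (Rint mu).

Let cptM : compact [set: M] := hom_manifold_compact hom.
Let cu m : continuous (u m) := @u_continuous _ _ _ _ _ _ _ _ _ _ _ _ eig m.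
Let uu m m' : cint (fun x => u m x * u m' x) = (m == m')%:R :=
  ip_u eig m m'.

Definition coef F m : R[i] := inner mu F (fun x => (u m x)%:C%C).

Lemma Re_sum (I : Type) (r : seq I) (w : I -> R[i]) :
  complex.Re (\sum_(i <- r) w i) = \sum_(i <- r) complex.Re (w i).
Proof. by elim/big_rec2: _ => // i a b _ <-; case: (w i) b => ? ? []. Qed.

Lemma Im_sum (I : Type) (r : seq I) (w : I -> R[i]) :
  complex.Im (\sum_(i <- r) w i) = \sum_(i <- r) complex.Im (w i).
Proof. by elim/big_rec2: _ => // i a b _ <-; case: (w i) b => ? ? []. Qed.

Lemma ReB (v w : R[i]) : complex.Re (v - w) = complex.Re v - complex.Re w.
Proof. by case: v w => ? ? []. Qed.

Lemma ImB (v w : R[i]) : complex.Im (v - w) = complex.Im v - complex.Im w.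
Proof. by case: v w => ? ? []. Qed.

Lemma Re_mulC (w : R[i]) (r : R) : complex.Re (w * r%:C%C) = complex.Re w * r.
Proof. by case: w => a b /=; rewrite mulr0 subr0. Qed.

Lemma Im_mulC (w : R[i]) (r : R) : complex.Im (w * r%:C%C) = complex.Im w * r.
Proof. by case: w => a b /=; rewrite mulr0 add0r. Qed.

(** Both the frame elements and the band-limited functions f(a^(-2j) L) F are of this form. *)
Definition upoly (K : nat) z (x : M) : R[i] := \sum_(m < K) z m * (u m x)%:C%C.

Lemma Re_upoly K z x :
  complex.Re (upoly K z x) = \sum_(m < K) complex.Re (z m) * u m x.
Proof. by rewrite Re_sum; apply: eq_bigr => m _; rewrite Re_mulC. Qed.

Lemma Im_upoly K z x :
  complex.Im (upoly K z x) = \sum_(m < K) complex.Im (z m) * u m x.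
Proof. by rewrite Im_sum; apply: eq_bigr => m _; rewrite Im_mulC. Qed.

Lemma upolyE K z : upoly K z = fun x => Complex
  (\sum_(m < K) complex.Re (z m) * u m x) (\sum_(m < K) complex.Im (z m) * u m x).
Proof.
apply/funext => x; rewrite -Re_upoly -Im_upoly; by case: (upoly K z x).
Qed.

Lemma continuous_sum_u K (c : nat -> R) :
  continuous (fun x => \sum_(m < K) c m * u m x).
Proof. by apply: continuous_fun_sum => m; exact: continuous_funZ. Qed.

Lemma upoly_L2 K z : L2 mu (upoly K z).
Proof.
rewrite upolyE; apply: square_integrable_L2;
  apply: (continuous_square_integrable mu cptM) => /=.
  exact: (@continuous_sum_u K (fun m => complex.Re (z m))).
exact: (@continuous_sum_u K (fun m => complex.Im (z m))).
Qed.

Lemma coefE F m : L2 mu F -> coef F m =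
  Complex (cint (fun x => complex.Re (F x) * u m x))
          (cint (fun x => complex.Im (F x) * u m x)).
Proof.
move=> L2F; rewrite /coef.
have c0 : continuous (fun _ : M => 0 : R) by move=> x; exact: cst_continuous.
have := innerE cptM L2F (@cu m) c0; rewrite -[X in inner mu F X]/(fun x => (u m x)%:C%C).
have z0 (p : M -> R) : cint (fun x => p x * 0) = 0.
  rewrite (_ : (fun x => _) = fun x => 0 * cst 0 x).
    by rewrite (cintZ mu cptM) ?mul0r// => x; exact: cst_continuous.
  by apply/funext => x; rewrite mulr0 mul0r.
by move=> ->; rewrite !z0 addr0 subr0.
Qed.

Lemma inner_upoly F K z : L2 mu F ->
  inner mu F (upoly K z) = \sum_(m < K) conjc (z m) * coef F m.
Proof.
move=> L2F; have [sRe sIm] := L2_square_integrable L2F.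
rewrite upolyE (innerE cptM L2F); last 2 first.
- exact: (@continuous_sum_u K (fun m => complex.Re (z m))).
- exact: (@continuous_sum_u K (fun m => complex.Im (z m))).
have cuo (m : 'I_K) : continuous (u m) by exact: cu.
rewrite !(Rint_mul_sum cptM) => //.
apply/eqP; rewrite eq_complex /= Re_sum Im_sum -sumrB -big_split /=.
apply/andP; split; apply/eqP; apply: eq_bigr => m _; rewrite (coefE _ L2F);
  case: (z m) => a b /=; ring.
Qed.

(** Bessel's identity for partial sums, stated for real functions and used on real and imaginary
    parts separately. *)
Lemma square_integrable_proj (p : M -> R) K : square_integrable mu p ->
  let c m := cint (fun x => p x * u m x) in
  square_integrable mu (fun x => p x - \sum_(m < K) c m * u m x) /\
  cint (fun x => (p x - \sum_(m < K) c m * u m x) ^+ 2) =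
    cint (fun x => p x ^+ 2) - \sum_(m < K) c m ^+ 2.
Proof.
move=> sp c; have cs := @continuous_sum_u K c.
have [sB ->] := square_integrableB cptM sp cs; split=> //.
have cuo (m : 'I_K) : continuous (u m) by exact: cu.
rewrite (Rint_mul_sum cptM)//.
have -> : \sum_(i < K) c i * cint (fun x => p x * u i x) = \sum_(m < K) c m ^+ 2.
  by apply: eq_bigr.
have -> : cint (fun x => (\sum_(m < K) c m * u m x) ^+ 2) =
    \sum_(m < K) c m ^+ 2; last by ring.
rewrite (Rint_mul_sum cptM)//; last exact: continuous_square_integrable.
apply: eq_bigr => i _; rewrite expr2; congr (_ * _).
transitivity (cint (fun x => u i x * \sum_(m < K) c m * u m x)).
  by congr cint; apply/funext => x; rewrite mulrC.
rewrite (Rint_mul_sum cptM)//; last exact: continuous_square_integrable.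
rewrite (bigD1 i)//= uu eqxx mulr1 big1 ?addr0// => m mi.
by rewrite uu eq_sym (negbTE (mi : (m : nat) != i)) mulr0.
Qed.

(** Bessel's identity computes the remainders of the expansion as the squared norm minus partial
    sums, and completeness of the basis says that they tend to 0. *)
Lemma parseval F : L2 mu F ->
  norm2 mu F = (\esum_(m in [set: nat]) (Normc.normc (coef F m) ^+ 2)%:E)%E.
Proof.
move=> L2F; have [sRe sIm] := L2_square_integrable L2F.
rewrite (norm2E L2F); set N := (X in X%:E).
pose s k := \sum_(m < k) Normc.normc (coef F m) ^+ 2.
have nE k : norm2 mu (fun x => F x - \sum_(m < k) coef F m * (u m x)%:C%C) =
    (N - s k)%:E.
  have [sB1 E1] := square_integrable_proj k sRe.
  have [sB2 E2] := square_integrable_proj k sIm.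
  pose H x := F x - \sum_(m < k) coef F m * (u m x)%:C%C.
  have HR : (fun x => complex.Re (H x)) = (fun x => complex.Re (F x) -
      \sum_(m < k) cint (fun x => complex.Re (F x) * u m x) * u m x).
    apply/funext => x; rewrite /H; transitivity (complex.Re (F x) -
        complex.Re (upoly k (coef F) x)); first exact: ReB.
    rewrite Re_upoly; congr (_ - _); apply: eq_bigr => m _.
    by rewrite (coefE _ L2F).
  have HI : (fun x => complex.Im (H x)) = (fun x => complex.Im (F x) -
      \sum_(m < k) cint (fun x => complex.Im (F x) * u m x) * u m x).
    apply/funext => x; rewrite /H; transitivity (complex.Im (F x) -
        complex.Im (upoly k (coef F) x)); first exact: ImB.
    rewrite Im_upoly; congr (_ - _); apply: eq_bigr => m _.
    by rewrite (coefE _ L2F).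
  have L2H : L2 mu H by apply: square_integrable_L2; rewrite ?HR ?HI.
  rewrite (norm2E L2H).
  have -> : (fun x => complex.Re (H x) ^+ 2) = (fun x => (complex.Re (F x) -
      \sum_(m < k) cint (fun x => complex.Re (F x) * u m x) * u m x) ^+ 2).
    by apply/funext => x; rewrite -[complex.Re (H x)]/((fun x => complex.Re (H x)) x) HR.
  have -> : (fun x => complex.Im (H x) ^+ 2) = (fun x => (complex.Im (F x) -
      \sum_(m < k) cint (fun x => complex.Im (F x) * u m x) * u m x) ^+ 2).
    by apply/funext => x; rewrite -[complex.Im (H x)]/((fun x => complex.Im (H x)) x) HI.
  rewrite E1 E2; congr (_%:E).
  have -> : s k = \sum_(m < k) cint (fun x => complex.Re (F x) * u m x) ^+ 2 +
      \sum_(m < k) cint (fun x => complex.Im (F x) * u m x) ^+ 2.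
    rewrite -big_split /=; apply: eq_bigr => m _.
    by rewrite (coefE _ L2F) sqr_normc.
  by rewrite /N; ring.
have [_ _ /(_ _ L2F)] := eig_basis eig.
under eq_fun do rewrite nE.
move=> /fine_cvgP[_ /= cvN].
have sN : s k @[k --> \oo] --> N.
  have -> : s = (fun k => N - (N - s k)) by apply/funext => k; ring.
  by rewrite -[X in _ --> X]subr0; apply: cvgB => //; exact: cvg_cst.
rewrite -nneseries_esumT => [|m]; last by rewrite lee_fin sqr_ge0.
apply/esym/cvg_lim => //.
rewrite (_ : (fun k => _) = (fun k => (s k)%:E)).
  by apply: cvg_EFin => //; exact: nearW.
by apply/funext => k; rewrite sumEFin big_mkord.
Qed.

Lemma mul_u_spectral (om w : R) i j : 4 * w <= om -> ev i <= w -> ev j <= w ->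
  spectral_space ev u om (fun x => (u i x * u j x)%:C%C).
Proof.
move=> wom iw jw; have [K KP] := spectral_cutoff eig (4 * w).
pose v x := u i x * u j x.
exists K, (fun m => (real_ip mu v (u m))%:C%C); apply/funext => x.
(* Indices below [K] have eigenvalue at most 4 w <= om, so the spectral condition in the sum is
   automatic. *)
rewrite (eq_bigl xpredT); last first.
  by move=> m; rewrite (le_trans _ wom)// KP.
under eq_bigr do rewrite -rmorphM.
rewrite -rmorph_sum; congr (_%:C)%C.
have cv : continuous v by apply: continuous_funM; exact: cu.
apply: (continuous_span_u hom mu_inv eig cv) => m Km.
apply: (ip_mul_u hom exp_spec mu_inv Q_inv X_on eig iw jw).
by rewrite ltNge KP -leqNgt.
Qed.

(** * Energy of band-limited functions sampled at the nodes *)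

Section cubature.
Variables (c1 c2 om rho w : R) (N : nat) (y : 'I_N -> M) (b : 'I_N -> R).
Hypotheses (cub : is_cubature n mu ev u c1 c2 om rho y b) (w_om : 4 * w <= om).

(** Sampled at the nodes, the low eigenfunctions remain orthonormal for the weighted discrete inner
    product; sampling is therefore an isometry on their span. *)
Lemma cubature_mul_u i j : ev i <= w -> ev j <= w ->
  \sum_k b k * (u i (y k) * u j (y k)) = (i == j)%:R.
Proof.
move=> iw jw; rewrite -uu.
have := cub_exact cub (mul_u_spectral w_om iw jw).
move=> /(congr1 (@complex.Re R)); rewrite Re_sum [LHS]/= /Rint => ->.
by apply: eq_bigr => k _; rewrite Re_mulC.
Qed.

Lemma cubature_sum_u K (c : nat -> R) : (forall m, (m < K)%N -> ev m <= w) ->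
  \sum_k b k * (\sum_(m < K) c m * u m (y k)) ^+ 2 = \sum_(m < K) c m ^+ 2.
Proof.
move=> Kw.
transitivity (\sum_(m < K) \sum_(p < K) c m * c p *
    \sum_k b k * (u m (y k) * u p (y k))).
  transitivity (\sum_k \sum_(m < K) \sum_(p < K) c m * c p *
      (b k * (u m (y k) * u p (y k)))).
    apply: eq_bigr => k _; rewrite expr2 mulr_suml mulr_sumr.
    apply: eq_bigr => m _; rewrite !mulr_sumr; apply: eq_bigr => p _; ring.
  rewrite exchange_big; apply: eq_bigr => m _; rewrite exchange_big.
  by apply: eq_bigr => p _; rewrite mulr_sumr.
apply: eq_bigr => m _; rewrite (bigD1 m)//= cubature_mul_u ?Kw// eqxx mulr1.
rewrite big1 ?addr0// => p pm; rewrite cubature_mul_u ?Kw//.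
by rewrite eq_sym (negbTE (pm : (p : nat) != m)) mulr0.
Qed.

Lemma cubature_upoly K z : (forall m, (m < K)%N -> ev m <= w) ->
  \sum_k b k * Normc.normc (upoly K z (y k)) ^+ 2 =
  \sum_(m < K) Normc.normc (z m) ^+ 2.
Proof.
move=> Kw.
transitivity (\sum_k
    (b k * (\sum_(m < K) complex.Re (z m) * u m (y k)) ^+ 2 +
     b k * (\sum_(m < K) complex.Im (z m) * u m (y k)) ^+ 2)).
  by apply: eq_bigr => k _; rewrite sqr_normc Re_upoly Im_upoly mulrDr.
rewrite big_split /= (cubature_sum_u (fun m => complex.Re (z m)) Kw).
rewrite (cubature_sum_u (fun m => complex.Im (z m)) Kw) -big_split /=.
by apply: eq_bigr => m _; rewrite sqr_normc.
Qed.

End cubature.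

(** * Frame coefficients at one scale and over all scales *)

Variables (a : R) (f : R -> R[i]).
Hypotheses (a_gt1 : 1 < a) (f_gen : is_generator a f).

Definition fval (j : int) (m : nat) : R[i] := f (a ^ (- 2 * j) * ev m).

Lemma f_support s : f s != 0 -> a ^- 2 <= s <= a ^+ 4.
Proof.
move=> fs; have := gen_support f_gen (@subset_closure _ [set s | f s != 0] s fs).
by rewrite /= in_itv.
Qed.

Lemma fval0 j : fval j 0 = 0.
Proof.
apply/eqP/negPn/negP => /f_support /andP[+ _].
by rewrite (ev_0 eig) mulr0 leNgt invr_gt0 exprn_gt0// (lt_trans _ a_gt1).
Qed.

(** The threshold is the right end a^4 of the support of [f], rescaled by a^(2j). *)
Lemma fval_eq0 j m : a ^ (2 * j + 4) < ev m -> fval j m = 0.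
Proof.
have a0 : 0 < a by rewrite (lt_trans _ a_gt1).
move=> evm; apply/eqP/negPn/negP => /f_support /andP[_].
apply/negP; rewrite -ltNge.
have -> : a ^+ 4 = a ^ (- 2 * j) * a ^ (2 * j + 4).
  by rewrite -expfzDr ?gt_eqF// mulNr addKr.
by rewrite ltr_pM2l// exprz_gt0.
Qed.

Lemma frame_eltE j K x b : (forall m, (K <= m)%N -> a ^ (2 * j + 4) < ev m) ->
  frame_elt ev u a f j x b =
  upoly K (fun m => (Num.sqrt b)%:C%C * (conjc (fval j m) * (u m x)%:C%C)).
Proof.
move=> KP; apply/funext => y; rewrite /frame_elt /upoly.
under [RHS]eq_bigr do rewrite -mulrA.
rewrite -mulr_sumr; congr (_ * _).
rewrite (@fsbig_ord _ _ _ K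
  (fun m => conjc (fval j m) * (u m x)%:C%C * (u m y)%:C%C)); apply/esym.
rewrite (fsbig_widen `I_K setT)//.
  by apply: eq_fsbigr => m _; rewrite conjc_real.
move=> m [_ /= /negP]; rewrite -leqNgt => /KP /fval_eq0 ->.
by rewrite conjc0 !mul0r.
Qed.

Lemma frame_energy j (c1 c2 rho : R) (N : nat) (y : 'I_N -> M) (b : 'I_N -> R) F :
  is_cubature n mu ev u c1 c2 (band d a j) rho y b -> L2 mu F ->
  (\sum_(k < N) (Normc.normc (inner mu F (frame_elt ev u a f j (y k) (b k))) ^+ 2)%:E
   = \esum_(m in [set: nat])
       (Normc.normc (coef F m) ^+ 2 * Normc.normc (fval j m) ^+ 2)%:E)%E.
Proof.
move=> cub L2F; have [K KP] := spectral_cutoff eig (a ^ (2 * j + 4)).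
have Kgt m : (K <= m)%N -> a ^ (2 * j + 4) < ev m by rewrite ltNge KP -leqNgt.
have a0 : 0 < a by rewrite (lt_trans _ a_gt1).
(* Since d >= 1, the band covers four times the largest eigenvalue seen by [f] at scale j, as
   products of two eigenfunctions require. *)
have wband : 4 * a ^ (2 * j + 4) <= band d a j.
  apply: ler_wpM2r; first by apply: exprz_ge0; exact: ltW.
  by rewrite ler_peMr ?ler0n// ler1n (dim_gt0 hom eig).
rewrite (@esum_ord _ K) => [|m|m Km]; last 2 first.
- by rewrite lee_fin mulr_ge0// sqr_ge0.
- by rewrite fval_eq0 ?Kgt// Normc.normc0 expr0n /= mulr0.
rewrite !sumEFin; congr (_%:E).
transitivity (\sum_(k < N) b k * Normc.normc
    (upoly K (fun m => fval j m * coef F m) (y k)) ^+ 2).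
  apply: eq_bigr => k _; rewrite (frame_eltE _ _ Kgt) inner_upoly//.
  (* The inner product is antilinear in its second argument, so the conjugate of [f] built into the
     frame element is undone and the value of f(a^(-2j) L) F at the node appears, times the root of
     the weight. *)
  have -> : \sum_(m < K) conjc ((Num.sqrt (b k))%:C%C *
      (conjc (fval j m) * (u m (y k))%:C%C)) * coef F m =
      (Num.sqrt (b k))%:C%C * upoly K (fun m => fval j m * coef F m) (y k).
    rewrite /upoly mulr_sumr; apply: eq_bigr => m _.
    have cM (v w : R[i]) : conjc (v * w) = conjc v * conjc w by exact: rmorphM.
    by rewrite !cM conjcK !conjc_real; ring.
  rewrite Normc.normcM exprMn; congr (_ * _).
  by rewrite sqr_normc /= expr0n /= addr0 sqr_sqrtr// ltW// (cub_pos cub).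
rewrite (cubature_upoly cub wband) => [|m]; last by rewrite KP.
apply: eq_bigr => m _.
by rewrite Normc.normcM exprMn mulrC.
Qed.

Lemma frame_total_energy F (c1 c2 : R) (rho : int -> R) (N : int -> nat)
    (y : forall j, 'I_(N j) -> M) (b : forall j, 'I_(N j) -> R) :
  (forall j, is_cubature n mu ev u c1 c2 (band d a j) (rho j) (y j) (b j)) ->
  L2 mu F ->
  (\esum_(j in [set: int]) \sum_(k < N j)
     (Normc.normc (inner mu F (frame_elt ev u a f j (y j k) (b j k))) ^+ 2)%:E =
   \esum_(m in [set: nat])
     (if m == 0%N then 0 else Normc.normc (coef F m) ^+ 2)%:E)%E.
Proof.
move=> cub L2F.
under eq_esum do rewrite (frame_energy (cub _) L2F).
rewrite esum_swap => [|j m]; last by rewrite lee_fin mulr_ge0// sqr_ge0.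
apply: eq_esum => m _; under eq_esum do rewrite EFinM.
rewrite esumZl => [||j]; last 2 first.
- exact: sqr_ge0.
- by rewrite lee_fin sqr_ge0.
(* The partition of unity holds only at positive arguments; at the eigenvalue 0 every scale
   contributes 0 instead. *)
case: eqP => [->|/eqP m0].
  rewrite [X in (_ * X)%E]esum1 ?mule0// => j _.
  by rewrite fval0 Normc.normc0 expr0n.
have evm : 0 < ev m by rewrite (lt_le_trans (ev_1 eig))// (ev_le eig)// lt0n.
by rewrite (gen_unity f_gen evm) mule1.
Qed.

(** As [u 0] is a constant c, its squared norm 1 is c times its integral. A constant orthogonal to
    [u 0] is therefore 0. *)
Lemma cint_u0_neq0 : cint (u 0) != 0.
Proof.
have [c _ u0c] := u0_constant hom exp_spec mu_inv eig.
apply/eqP => I0; have := uu 0 0.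
rewrite (_ : (fun x => _) = (fun x => c * u 0 x)); last first.
  by apply/funext => x; rewrite [in LHS]u0c u0c.
by rewrite (cintZ mu cptM)// I0 mulr0 => /eqP; rewrite eq_sym oner_eq0.
Qed.

Lemma L2_sub_constant F (w : R[i]) : L2 mu F ->
  L2 mu (fun x => F x - w) /\
  forall m, coef (fun x => F x - w) m = coef F m - w * (cint (u m))%:C%C.
Proof.
move=> L2F; have [sRe sIm] := L2_square_integrable L2F.
have cc (r : R) : continuous (fun _ : M => r) by move=> x; exact: cst_continuous.
have [sRe' _] := square_integrableB cptM sRe (@cc (complex.Re w)).
have [sIm' _] := square_integrableB cptM sIm (@cc (complex.Im w)).
have L2Fw : L2 mu (fun x => F x - w).
  apply: square_integrable_L2.
  - by under eq_fun do rewrite ReB.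
  - by under eq_fun do rewrite ImB.
split=> // m; rewrite (coefE _ L2F) (coefE _ L2Fw).
have key (p : M -> R) (r : R) : square_integrable mu p ->
    cint (fun x => (p x - r) * u m x) = cint (fun x => p x * u m x) - r * cint (u m).
  move=> sp; rewrite -mulNr -(cintZ mu cptM)// -RintD.
  - by congr cint; apply/funext => x; rewrite mulrBl mulNr.
  - exact: square_integrableM.
  - by apply: (continuous_integrable mu cptM); exact: continuous_funZ.
have -> : (fun x => complex.Re (F x - w) * u m x) =
    (fun x => (complex.Re (F x) - complex.Re w) * u m x).
  by apply/funext => x; rewrite ReB.
have -> : (fun x => complex.Im (F x - w) * u m x) =
    (fun x => (complex.Im (F x) - complex.Im w) * u m x).
  by apply/funext => x; rewrite ImB.
rewrite !key//; apply/eqP; rewrite eq_complex.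
by rewrite ReB ImB Re_mulC Im_mulC /= !eqxx.
Qed.

Lemma coef_upoly0 K z : z 0%N = 0 -> coef (upoly K z) 0 = 0.
Proof.
move=> z0; rewrite (coefE _ (upoly_L2 K z)).
have key (c : nat -> R) : c 0%N = 0 ->
    cint (fun x => (\sum_(m < K) c m * u m x) * u 0 x) = 0.
  move=> c0; transitivity (cint (fun x => u 0 x * \sum_(m < K) c m * u m x)).
    by congr cint; apply/funext => x; rewrite mulrC.
  rewrite (Rint_mul_sum cptM); last first.
  - by move=> m; exact: cu.
  - exact: continuous_square_integrable.
  apply: big1 => m _; rewrite uu.
  by case: eqP => [<-|]; rewrite ?c0 ?mul0r ?mulr0.
have -> : (fun x => complex.Re (upoly K z x) * u 0 x) =
    (fun x => (\sum_(m < K) complex.Re (z m) * u m x) * u 0 x).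
  by apply/funext => x; rewrite Re_upoly.
have -> : (fun x => complex.Im (upoly K z x) * u 0 x) =
    (fun x => (\sum_(m < K) complex.Im (z m) * u m x) * u 0 x).
  by apply/funext => x; rewrite Im_upoly.
by rewrite (key (fun m => complex.Re (z m))) ?z0//
  (key (fun m => complex.Im (z m))) ?z0.
Qed.

(** * The orthogonal complement of the constants *)

Variable P : (M -> R[i]) -> M -> R[i].
Hypothesis P_proj : is_orthogonal_projection mu (@constants R M) P.

Lemma coef_compl0 F : L2 mu F -> coef (fun x => F x - P F x) 0 = 0.
Proof.
move=> L2F; have [_ orth] := P_proj L2F; apply: orth.
have [c _ u0c] := u0_constant hom exp_spec mu_inv eig.
by exists c%:C%C; apply/funext => x; rewrite u0c.
Qed.

(** Subtracting a constant affects only the coefficient along [u 0], because later eigenfunctions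
    have integral 0; orthogonality to constants makes that coefficient 0. *)
Lemma norm2_compl F : L2 mu F ->
  norm2 mu (fun x => F x - P F x) = (\esum_(m in [set: nat])
     (if m == 0%N then 0 else Normc.normc (coef F m) ^+ 2)%:E)%E.
Proof.
move=> L2F; have [[w PFw] _] := P_proj L2F.
have c0 := coef_compl0 L2F; rewrite PFw in c0 *.
have [L2Fw cE] := L2_sub_constant w L2F.
rewrite (parseval L2Fw); apply: eq_esum => m _.
case: eqP => [->|/eqP m0]; first by rewrite c0 Normc.normc0 expr0n.
rewrite cE (cint_u hom exp_spec mu_inv eig) ?lt0n//.
by rewrite (_ : (0 : R)%:C%C = 0)// mulr0 subr0.
Qed.

(** The frame element is its own preimage. It has no component along [u 0], so if its projection is
    the constant w, orthogonality of the difference to [u 0] leaves w times the integral of [u 0]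
    equal to 0, whence w = 0. *)
Lemma frame_elt_range (j : int) x b : in_range_compl mu P (frame_elt ev u a f j x b).
Proof.
have [K KP] := spectral_cutoff eig (a ^ (2 * j + 4)).
have Kgt m : (K <= m)%N -> a ^ (2 * j + 4) < ev m by rewrite ltNge KP -leqNgt.
rewrite (frame_eltE _ _ Kgt); set z := (fun m : nat => _).
have z0 : z 0%N = 0 by rewrite /z fval0 conjc0 mul0r mulr0.
have L2z := upoly_L2 K z; split=> //; exists (upoly K z) => //.
have [[w Pw] _] := P_proj L2z.
have := coef_compl0 L2z; rewrite Pw.
have [_ ->] := L2_sub_constant w L2z; rewrite coef_upoly0// sub0r.
move/eqP; rewrite oppr_eq0 mulf_eq0 => /orP[/eqP w0|].
  by apply: aeW => y; rewrite w0 subr0.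
by rewrite eq_complex /= eqxx andbT (negbTE cint_u0_neq0).
Qed.

End frame.

Theorem mainTheorem3 (R : realType) (d n : nat)
  (* M = G/K *)
  (G : ptopologicalGroupType) (M : ptopologicalType)
  (A : charted 'rV[R]_d G) (B : charted 'rV[R]_n M) (act : G -> M -> M)
  (hom : is_homogeneous A B act)
  (* invariant Riemannian metric and measure *)
  (h : M -> 'M[R]_n)
  (h_metric : is_riemannian_metric B h) (h_inv : invariant_metric B act h)
  (mu : {finite_measure set (borel M) -> \bar R})
  (mu_riemannian : is_riemannian_measure B h mu)
  (mu_inv : invariant_measure act mu)
  (* the operator L and its spectral resolution *)
  (expG : 'rV[R]_d -> G) (exp_spec : is_exponential A expG)
  (Q : 'rV[R]_d -> R) (Q_inv : is_invariant_form A Q)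
  (X : 'I_d -> 'rV[R]_d) (X_on : is_orthonormal_family Q X)
  (ev : nat -> R) (u : nat -> M -> R)
  (eig : is_eigenbasis B act expG X mu ev u)
  (* lattice and cubature constants *)
  (NM : nat) (rhoM : R) (lat : lattice_constants B h NM rhoM)
  (a0 c1 c2 : R) (cub : cubature_constants B h NM rhoM mu ev u a0 c1 c2)
  (* the frame *)
  (a : R) (a_gt1 : 1 < a) (f : R -> R[i]) (f_gen : is_generator a f)
  (N : int -> nat) (x : forall j : int, 'I_(N j) -> M)
  (x_lat : forall j, is_rho_lattice B h NM rhoM (mesh a0 (band d a j)) (x j))
  (b : forall j : int, 'I_(N j) -> R)
  (b_cub : forall j, is_cubature n mu ev u c1 c2
             (band d a j) (mesh a0 (band d a j)) (x j) (b j))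
  (P : (M -> R[i]) -> M -> R[i])
  (P_proj : is_orthogonal_projection mu (@constants R M) P) :
  let phi (j : int) (k : 'I_(N j)) : M -> R[i] :=
    frame_elt ev u a f j (x j k) (b j k) in
  (forall j k, in_range_compl mu P (phi j k)) /\
  (forall F : M -> R[i], L2 mu F ->
     norm2 mu (fun y => F y - P F y) =
     (\esum_(j in [set: int])
        \sum_(k < N j) (Normc.normc (inner mu F (phi j k)) ^+ 2)%:E)%E).
Proof.
move=> phi; split=> [j k|F L2F].
  exact: (frame_elt_range hom exp_spec mu_inv eig a_gt1 f_gen P_proj).
rewrite (norm2_compl hom exp_spec mu_inv eig P_proj L2F); apply: esym.
exact: (frame_total_energy hom exp_spec mu_inv Q_inv X_on eig a_gt1 f_gen
  b_cub L2F).
Qed.
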